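(* The connectivity problem for an input graph $H$ on topology $G$ with set of players $K$ requires $\tilde\Omega\left(\tau_{\mathrm{MCF}}\left(G,K,\frac{M_H+N_H}{k}\right)\right)$ rounds of communication, even for randomized protocols; moreover this holds when $H$ is given as an $O(M_H/k+\Delta_H)$-balanced node distribution, and also as an $O(M_H/k+\Delta_H)$-balanced edge distribution.
   Context: Each player $u\in K$ receives a graph $H_u$ on a common vertex set $V(H)$ (known to all players); the players must decide whether $H=\bigcup_{u\in K}H_u$ is connected. $N_H,M_H,\Delta_H$ denote the number of vertices, number of edges and maximum degree of $H$. In a node distribution the adjacency list of each vertex of $H$ is assigned as a whole to one terminal (all terminals know the assignment, only that terminal knows the list); in an edge distribution $E(H)$ is partitioned among the terminals. The distribution is $M$-balanced if every $H_u$ has size at most $M$ (sum of degrees of assigned vertices, resp. number of assigned edges). Communication model: $G$ undirected graph, $K\subseteq V(G)$, $k=|K|$; in each synchronous round every node sends a (possibly different) bit to each neighbour, both directions usable simultaneously; protocols know $G$ and may use public randomness; all terminals must learn the answer. Timed graph $G^{(\tau)}$: directed graph on $V\times[0,\tau]$ with unit-capacity edges $((u,i),(v,i+1))$, $((v,i),(u,i+1))$ for $(u,v)\in E(G)$, $0\le i<\tau$, and infinite-capacity edges $((u,i),(u,i+1))$. $\tau_{\mathrm{MCF}}(G,K,n')$: minimum $\tau$ such that a capacity-respecting multicommodity flow in $G^{(\tau)}$ sends $n'/k$ units from $(u,0)$ to $(v,\tau)$ for every ordered pair $u,v\in K$. $\tilde\Omega$ ignores poly-logarithmic factors. *)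

(* Defs.v *)
From mathcomp Require Import all_boot all_order all_algebra.
From mathcomp Require Import boolp classical_sets reals constructive_ereal ereal.
From mathcomp Require Import exp.

Set Implicit Arguments.
Unset Strict Implicit.
Unset Printing Implicit Defensive.

Import Order.TTheory GRing.Theory Num.Theory.
Local Open Scope ring_scope.

(* A finite simple graph on a fixed vertex set is given by its edge set, a set
   of unordered pairs.  Unions and partitions of graphs on a common vertex set
   are then unions and partitions of edge sets. *)
Record sgraph (T : finType) := SGraph {
  edge_set :> {set {set T}};
  edge_setP : [forall e in edge_set, #|e| == 2%N] }.

Section Graphs.
Variables (T : finType) (H : {set {set T}}).

Definition adj : rel T := [rel x y | [set x; y]%SET \in H].

Definition deg (w : T) : nat := #|[set e in H | w \in e]%SET|.

Definition max_deg : nat := (\max_(w : T) deg w)%N.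

Definition connected_graph : bool := [forall x, forall y, connect adj x y].

End Graphs.

Section Protocols.
Variables (V : finType) (G : sgraph V) (I : Type).

(* What a node has received so far: entry [i] maps each neighbour to the bit it
   sent in round [i] (non-neighbours are mapped to [false]).  The length of the
   history is the index of the current round. *)
Definition history := seq {ffun V -> bool}.

(* [send u i h v] is the bit that node [u], with input [i] and history [h],
   sends to its neighbour [v] in the current round. *)
Record protocol := Protocol {
  send : V -> I -> history -> V -> bool;
  output : V -> I -> history -> bool }.

Fixpoint received (Pi : protocol) (x : V -> I) (t : nat) : V -> history :=
  if t is s.+1 then
    fun v => rcons (received Pi x s v)
               [ffun u => adj G u v && send Pi u (x u) (received Pi x s u) v]
  else fun=> [::].

Definition answer (Pi : protocol) (x : V -> I) (t : nat) (v : V) : bool :=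
  output Pi v (x v) (received Pi x t v).

End Protocols.

Section Connectivity.
Variables (R : realType) (V : finType) (G : sgraph V) (K : {set V}).
Variables (N M : nat).

(* The vertex set of the input graph [H] is ['I_N].  A distribution maps each
   node [u] of [G] to the edge set of [H_u], empty for non-terminals. *)
Definition distribution := V -> {set {set 'I_N}}.

Definition covers (x : distribution) (H : sgraph 'I_N) : Prop :=
  (forall u, u \notin K -> x u = finset.set0) /\
  (\bigcup_(u in K) x u)%SET = H.

(* [s w] is the terminal that is assigned the adjacency list of [w]. *)
Definition node_distribution (s : 'I_N -> V) (H : sgraph 'I_N) : distribution :=
  fun u => [set e in edge_set H | [exists w in e, s w == u]]%SET.

Definition node_balanced (B : R) (s : 'I_N -> V) (H : sgraph 'I_N) : Prop :=
  forall u, u \in K -> (\sum_(w | s w == u) deg H w)%N%:R <= B.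

Definition edge_distribution (x : distribution) (H : sgraph 'I_N) : Prop :=
  covers x H /\ {in K &, forall u v, u != v -> [disjoint x u & x v]}.

Definition edge_balanced (B : R) (x : distribution) : Prop :=
  forall u, u \in K -> #|x u|%:R <= B.

(* [B = C * (M_H / k + Delta_H)] *)
Definition balance (C : R) (H : sgraph 'I_N) : R :=
  C * (#|edge_set H|%:R / #|K|%:R + (max_deg H)%:R).

(* A family of admissible pairs (distribution, input graph). *)
Definition input_family := distribution -> sgraph 'I_N -> Prop.

Definition any_inputs : input_family := covers.

Definition node_inputs (C : R) (s : 'I_N -> V) : input_family := fun x H =>
  x = node_distribution s H /\ node_balanced (balance C H) s H.

Definition edge_inputs (C : R) : input_family := fun x H =>
  edge_distribution x H /\ edge_balanced (balance C H) x.

(* Public-coin protocols are finitely supported distributions over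
   deterministic ones.  This loses no generality: for fixed [G], [N] and [t]
   there are only finitely many behaviours of deterministic [t]-round
   protocols. *)
Definition solves_connectivity (Omega : finType) (P : Omega -> R)
    (Pi : Omega -> protocol V {set {set 'I_N}}) (t : nat)
    (D : input_family) : Prop :=
  forall x H, D x H -> #|edge_set H| = M ->
    2 / 3 <= \sum_(w | [forall u in K,
                         answer G (Pi w) x t u == connected_graph H]) P w.

Definition requires_rounds (D : input_family) (b : \bar R) : Prop :=
  forall (Omega : finType) (P : Omega -> R)
    (Pi : Omega -> protocol V {set {set 'I_N}}) (t : nat),
    (forall w, 0 <= P w) -> \sum_w P w = 1 ->
    solves_connectivity P Pi t D -> (b <= t%:R%:E)%E.

End Connectivity.

Section TimedFlow.
Variables (R : realType) (V : finType) (G : sgraph V) (K : {set V}).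

Definition timed_node (tau : nat) : finType := (V * 'I_tau.+1)%type.

Definition timed_cap (tau : nat) (p q : timed_node tau) : \bar R :=
  if (q.2 == p.2.+1 :> nat) then
    if q.1 == p.1 then +oo%E
    else if adj G p.1 q.1 then 1%E else 0%E
  else 0%E.

(* [f u v p q] is the amount of commodity [(u, v)] sent along the arc [(p, q)]
   of the timed graph. *)
Definition mcf_feasible (n' : R) (tau : nat) : Prop :=
  exists f : V -> V -> timed_node tau -> timed_node tau -> R,
  [/\ forall u v p q, 0 <= f u v p q,
      {in K &, forall u v (p : timed_node tau),
        \sum_q f u v p q - \sum_q f u v q p =
        n' / #|K|%:R * ((p == (u, ord0))%:R - (p == (v, ord_max))%:R)}
    & forall p q,
        ((\sum_(u in K) \sum_(v in K) f u v p q)%:E <= timed_cap p q)%E].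

(* The minimum over [nat], with value [+oo] when no horizon is feasible, i.e.
   when some terminals are not connected in [G] and [n' > 0]. *)
Definition tau_MCF (n' : R) : \bar R :=
  ereal_inf [set y | exists2 tau, mcf_feasible n' tau & y = tau%:R%:E]%classic.

End TimedFlow.

(* Main.v *)
Require Import Defs.
From mathcomp Require Import all_boot all_order all_algebra.
From mathcomp Require Import boolp reals constructive_ereal ereal exp.
From mathcomp Require Import zify ring lra.

Set Implicit Arguments.
Unset Strict Implicit.
Unset Printing Implicit Defensive.

Import Order.TTheory GRing.Theory Num.Theory.
Local Open Scope ring_scope.

(**
If the multicommodity flow is infeasible within [tau] rounds, linear
programming duality gives weights on the timed arcs, of small total weight,
for which many pairs of terminals are far apart.  Summing the weights over
time gives a static length function on the edges of [G] for which the pairs of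
terminals joined by walks of at most [tau / 2] edges remain far apart.  After
restriction to one dyadic level of distances and rounding to integers, a
region growing argument yields sets [A] and [B] of terminals at distance
[beta], about [tau / log^2 k], such that the lengths exceed [1] by a small
total amount compared with [(M + N) / k * min(#|A|, #|B|)].

A protocol with at most [beta / 2] rounds is then simulated by two parties:
the first one simulates a shrinking ball around [A], the second one the
complement of a growing ball, and they only exchange bits along edges of
length greater than [1], as many as the excess length.

Finally, the connectivity problem contains the inner product modulo 2 of the
inputs of the two parties.  The input graph consists of four tracks carrying
the elements of [F_2^2]; each pair of input bits [(x, y)] contributes a
commutator of two involutions of [F_2^2], which is the translation by
[(x y, 0)].  A few extra edges at both ends make the graph connected exactly
when the total translation is not zero.  By Lindsey's lemma the inner product
of [m] bits cannot be computed, even with error [1 / 3], by exchanging fewer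
than about [m / 2] bits.
*)

(** * Farkas' lemma *)

(** Chooses the eliminated variable: the largest lower bound or, if there is none, the smallest
    upper bound. *)
Lemma separating_point (R : realFieldType) (I : finType) (P Q : pred I)
    (l u : I -> R) :
  (forall k i, Q k -> P i -> l k <= u i) ->
  exists x, (forall k, Q k -> l k <= x) /\ (forall i, P i -> x <= u i).
Proof.
move=> lu; case: (pickP Q) => [k0 Qk0 | Q0].
  case: (@arg_maxP _ _ _ k0 Q l Qk0) => k Qk lk.
  by exists (l k); split=> i Hi; [apply: lk | apply: lu].
case: (pickP P) => [i0 Pi0 | P0].
  case: (@arg_minP _ _ _ i0 P u Pi0) => i Pi ui.
  by exists (u i); split=> k; [rewrite Q0 | apply: ui].
by exists 0; split=> i; rewrite ?Q0 ?P0.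
Qed.

(* Fourier-Motzkin elimination: the rows of the eliminated system are
   nonnegative combinations, collected in [c], of the rows of the old one. *)
Lemma farkas (R : realFieldType) n : forall (I : finType)
    (A : I -> 'I_n -> R) (b : I -> R),
  (exists x : 'I_n -> R, forall i, \sum_j A i j * x j <= b i) \/
  (exists y : I -> R, [/\ forall i, 0 <= y i,
     forall j, \sum_i y i * A i j = 0 & \sum_i y i * b i < 0]).
Proof.
elim: n => [|n IHn] I A b.
  case: (pickP (fun i => b i < 0)) => [i bi | b_ge0].
    right; exists (fun j => (j == i)%:R); split=> [j | [] // |].
      by rewrite ler0n.
    rewrite (bigD1 i) //= eqxx mul1r big1 ?addr0 // => j /negPf ->.
    by rewrite mul0r.
  by left; exists (fun=> 0) => i; rewrite big_ord0 leNgt b_ge0.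
pose a i := A i ord0.
(* Row [inl l] keeps a row free of the eliminated variable; row [inr (l, k)] cancels a positive
   coefficient against a negative one. All other indices give the trivial row [0 <= 0]. *)
pose c (r : I + I * I) i := match r with
  | inl l => ((a l == 0) && (i == l))%:R
  | inr (l, k) => if (0 < a l) && (a k < 0)
      then - a k * (i == l)%:R + a l * (i == k)%:R else 0 end.
have sumd (F : I -> R) l : \sum_i (i == l)%:R * F i = F l.
  rewrite (bigD1 l) //= eqxx mul1r big1 ?addr0 // => j /negPf ->.
  by rewrite mul0r.
have cl F l : a l == 0 -> \sum_i c (inl l) i * F i = F l.
  by move=> al; rewrite -[RHS](sumd F); apply: eq_bigr => i _ /=; rewrite al.
have cr F l k : 0 < a l -> a k < 0 ->
    \sum_i c (inr (l, k)) i * F i = - a k * F l + a l * F k.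
  move=> al ak; rewrite -[in RHS](sumd F) -[in RHS](sumd F k) !mulr_sumr.
  rewrite -big_split /=; apply: eq_bigr => i _; rewrite al ak /=; ring.
have c_ge0 r i : 0 <= c r i.
  case: r => [l | [l k]] /=; first by rewrite ler0n.
  case: ifP => // /andP[al ak].
  by rewrite addr_ge0 // mulr_ge0 ?ler0n ?oppr_ge0 // ltW.
have c_a r : \sum_i c r i * a i = 0.
  case: r => [l | [l k]].
    have [al | al] := boolP (a l == 0); first by rewrite cl //; apply/eqP.
    by rewrite big1 // => i _ /=; rewrite (negPf al) mul0r.
  have [/andP[al ak] | nak] := boolP ((0 < a l) && (a k < 0)).
    by rewrite cr //; ring.
  by rewrite big1 // => i _ /=; rewrite (negPf nak) mul0r.
case: (IHn _ (fun r j => \sum_i c r i * A i (lift ord0 j))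
             (fun r => \sum_i c r i * b i)) => [[x Hx] | [y [y0 yA yb]]].
  left; pose s i := \sum_j A i (lift ord0 j) * x j.
  have Hs r : \sum_i c r i * s i <= \sum_i c r i * b i.
    apply: le_trans (Hx r); rewrite le_eqVlt; apply/orP; left; apply/eqP.
    under eq_bigr => i _ do rewrite mulr_sumr.
    rewrite exchange_big; apply: eq_bigr => j _; rewrite mulr_suml.
    by apply: eq_bigr => i _; rewrite mulrA.
  have [k i ak ai | z [zl zu]] := @separating_point R I
    (fun i => 0 < a i) (fun i => a i < 0)
    (fun i => (b i - s i) / a i) (fun i => (b i - s i) / a i).
    have := Hs (inr (i, k)); rewrite !cr // => H.
    rewrite ler_pdivlMr // mulrAC ler_ndivrMr //; lra.
  exists (fun j => oapp x z (unlift ord0 j)) => i.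
  rewrite big_ord_recl unlift_none /=.
  under eq_bigr => j _ do rewrite liftK /=.
  rewrite -/(s i) -/(a i); case: (ltgtP (a i) 0) => ai.
  - have := zl i ai; rewrite ler_ndivrMr // mulrC lerBrDr; exact.
  - have := zu i ai; rewrite ler_pdivlMr // mulrC lerBrDr; exact.
  - by have := Hs (inl i); rewrite !cl ?ai ?mul0r ?add0r //.
right; exists (fun i => \sum_r y r * c r i).
have sumy (F : I -> R) :
    \sum_i (\sum_r y r * c r i) * F i = \sum_r y r * \sum_i c r i * F i.
  under eq_bigr => i _ do rewrite mulr_suml.
  rewrite exchange_big; apply: eq_bigr => r _; rewrite mulr_sumr.
  by apply: eq_bigr => i _; rewrite mulrA.
split=> [i | j |]; last by rewrite sumy.
  by apply: sumr_ge0 => r _; rewrite mulr_ge0.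
rewrite sumy; case: (unliftP ord0 j) => [j' -> | ->]; first exact: yA.
by rewrite big1 // => r _; rewrite c_a mulr0.
Qed.

(** The sign constraints become rows [- x j <= 0], whose multipliers are the slack in
    [0 <= \sum_i y i * A i j]. *)
Lemma farkas_ge0 (R : realFieldType) (J I : finType)
    (A : I -> J -> R) (b : I -> R) :
  (exists x : J -> R, (forall j, 0 <= x j) /\
     forall i, \sum_j A i j * x j <= b i) \/
  (exists y : I -> R, [/\ forall i, 0 <= y i,
     forall j, 0 <= \sum_i y i * A i j & \sum_i y i * b i < 0]).
Proof.
pose A' (r : I + J) (j : 'I_#|J|) := match r with
  | inl i => A i (enum_val j) | inr k => - (k == enum_val j)%:R end.
pose b' (r : I + J) := if r is inl i then b i else 0.
case: (farkas A' b') => [[x Hx] | [y [y0 yA yb]]].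
  left; exists (fun j => x (enum_rank j)); split=> [j | i].
    have := Hx (inr j); rewrite /= (bigD1 (enum_rank j)) //= enum_rankK eqxx.
    rewrite big1 => [|l]; first by rewrite addr0 mulN1r oppr_le0.
    rewrite -[l]enum_valK (inj_eq enum_rank_inj) enum_rankK eq_sym.
    by move=> /negPf->; rewrite mulNr mul0r oppr0.
  apply: le_trans (Hx (inl i)); rewrite le_eqVlt; apply/orP; left; apply/eqP.
  rewrite (reindex _ (onW_bij _ (@enum_rank_bij J))) /=.
  by apply: eq_bigr => j _; rewrite enum_rankK.
right; exists (fun i => y (inl i)); split=> [i // | j |].
  have := yA (enum_rank j); rewrite big_sumType /= => /eqP.
  rewrite enum_rankK (bigD1 (P := xpredT) j) //= eqxx [X in _ + (_ + X)]big1
      => [|l /negPf->].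
    by rewrite mulrN1 addr0 subr_eq0 => /eqP ->.
  by rewrite oppr0 mulr0.
move: yb; rewrite big_sumType /= [X in _ + X]big1 ?addr0 // => l _.
by rewrite mulr0.
Qed.

(** * Duality for timed flows *)

Lemma sum_delta (R : realFieldType) (J : finType) (j0 : J) (F : J -> R) :
  \sum_j (j == j0)%:R * F j = F j0.
Proof.
rewrite (bigD1 j0) //= eqxx mul1r big1 ?addr0 // => j /negPf ->.
by rewrite mul0r.
Qed.

Lemma sum_pair (R : realFieldType) (A B : finType) (F : A * B -> R) :
  \sum_j F j = \sum_a \sum_b F (a, b).
Proof. by rewrite pair_bigA; apply: eq_bigr => -[]. Qed.

Section FlowDuality.
Variables (R : realType) (V : finType) (G : sgraph V) (K : {set V}).

Lemma adj_sym : symmetric (adj G).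
Proof. by move=> a b; rewrite /adj /= setUC. Qed.

Lemma mcf_dual (n' : R) tau : ~ mcf_feasible G K n' tau ->
  exists (w : nat -> V -> V -> R) (phi : V -> V -> nat -> V -> R),
  [/\ forall i a b, 0 <= w i a b,
      {in K &, forall u v i a, (i < tau)%N -> phi u v i a <= phi u v i.+1 a},
      {in K &, forall u v i a b, (i < tau)%N -> adj G a b ->
         phi u v i a - phi u v i.+1 b <= w i a b}
    & \sum_(i < tau) \sum_a \sum_(b | adj G a b) w i a b <
      n' / #|K|%:R * \sum_(u in K) \sum_(v in K)
        (phi u v 0%N u - phi u v tau v)].
Proof.
move=> infeas; set D := n' / _.
pose TN := timed_node V tau.
(* Commodities range over all of [V * V]; this factor empties the rows of pairs that are not pairs
   of terminals. *)
pose inK (uv : V * V) : R := ((uv.1 \in K) && (uv.2 \in K))%:R.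
pose src (uv : V * V) : TN := (uv.1, ord0).
pose snk (uv : V * V) : TN := (uv.2, ord_max).
pose stay (pq : TN * TN) := (pq.2.2 == pq.1.2.+1 :> nat) && (pq.2.1 == pq.1.1).
pose unit_arc (pq : TN * TN) :=
  (pq.2.2 == pq.1.2.+1 :> nat) && adj G pq.1.1 pq.2.1.
pose con uvp (j : (V * V) * (TN * TN)) : R :=
  inK uvp.1 * ((j.1 == uvp.1)%:R * ((j.2.1 == uvp.2)%:R - (j.2.2 == uvp.2)%:R)).
pose bal uvp : R :=
  inK uvp.1 * (D * ((uvp.2 == src uvp.1)%:R - (uvp.2 == snk uvp.1)%:R)).
pose A (i : (V * V * TN + V * V * TN) + TN * TN) j : R := match i with
  | inl (inl uvp) => con uvp j
  | inl (inr uvp) => - con uvp j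
  | inr pq => (~~ stay pq)%:R * ((j.2 == pq)%:R * inK j.1) end.
pose b (i : (V * V * TN + V * V * TN) + TN * TN) : R := match i with
  | inl (inl uvp) => bal uvp
  | inl (inr uvp) => - bal uvp
  | inr pq => (unit_arc pq)%:R end.
have sum_con x uv p : \sum_j con (uv, p) j * x j =
    inK uv * (\sum_q x (uv, (p, q)) - \sum_q x (uv, (q, p))).
  rewrite sum_pair /=.
  under eq_bigr => uv' _.
    under eq_bigr => pq _ do rewrite /con /= -!mulrA mulrCA.
    rewrite -mulr_sumr; over.
  rewrite sum_delta -mulr_sumr; congr (_ * _).
  transitivity (\sum_pq ((pq.1 == p)%:R * x (uv, pq) - (pq.2 == p)%:R * x (uv, pq))).
    by apply: eq_bigr => pq _; rewrite mulrBl.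
  rewrite sumrB; congr (_ - _).
    rewrite sum_pair /=.
    by under eq_bigr => p' _ do rewrite -mulr_sumr; rewrite sum_delta.
  rewrite sum_pair /=.
  by apply: eq_bigr => p' _; rewrite sum_delta.
have sum_cap x pq :
    \sum_j (j.2 == pq)%:R * inK j.1 * x j = \sum_uv inK uv * x (uv, pq).
  rewrite sum_pair /=.
  by apply: eq_bigr => uv _; under eq_bigr => pq' _ do rewrite -mulrA;
    rewrite sum_delta.
have sumK (F : V -> V -> R) : \sum_uv inK uv * F uv.1 uv.2 =
    \sum_(u in K) \sum_(v in K) F u v.
  rewrite pair_big_dep /= [RHS]big_mkcond /=; apply: eq_bigr => uv _.
  by rewrite /inK; case: ifP => _; rewrite ?mul1r ?mul0r.
case: (farkas_ge0 A b) => [[x [x0 Hx]] | [y [y0 yA yb]]].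
  case: infeas; exists (fun u v p q => x ((u, v), (p, q))).
  split=> [u v p q | u v uK vK p | p q]; first exact: x0.
    have inK1 : inK (u, v) = 1 by rewrite /inK uK vK.
    have := Hx (inl (inl (u, v, p))); have := Hx (inl (inr (u, v, p))).
    rewrite /A /b; under eq_bigr => j _ do rewrite mulNr.
    rewrite sumrN lerN2 sum_con /bal /src /snk inK1 !mul1r => l1 l2.
    by apply/eqP; rewrite eq_le l1 l2.
  rewrite -(sumK (fun u v => x ((u, v), (p, q)))).
  have := Hx (inr (p, q)); rewrite /A /b /stay /unit_arc /timed_cap /=.
  have -> : \sum_j (~~ ((q.2 == p.2.+1 :> nat) && (q.1 == p.1)))%:R *
      ((j.2 == (p, q))%:R * inK j.1) * x j =
      (~~ ((q.2 == p.2.+1 :> nat) && (q.1 == p.1)))%:R *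
      \sum_uv inK uv * x (uv, (p, q)).
    by rewrite -sum_cap mulr_sumr; apply: eq_bigr => j _; rewrite !mulrA.
  case: eqP => _ /=; last first.
    rewrite mul1r lee_fin.
    by under [X in _ -> X <= _]eq_bigr => uv _ do rewrite -surjective_pairing.
  case: eqP => _ /=; first by rewrite leey.
  rewrite mul1r; case: ifP => _; rewrite lee_fin;
    by under [X in _ -> X <= _]eq_bigr => uv _ do rewrite -surjective_pairing.
pose w i a b : R := y (inr ((a, inord i), (b, inord i.+1))).
pose phi u v i a : R :=
  y (inl (inr (u, v, (a, inord i)))) - y (inl (inl (u, v, (a, inord i)))).
have arc u v p q : u \in K -> v \in K ->
    (y (inl (inr (u, v, p))) - y (inl (inl (u, v, p)))) -
    (y (inl (inr (u, v, q))) - y (inl (inl (u, v, q)))) <=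
    (~~ stay (p, q))%:R * y (inr (p, q)).
  move=> uK vK; have := yA ((u, v), (p, q)); rewrite !big_sumType /=.
  have inK1 : inK (u, v) = 1 by rewrite /inK uK vK.
  have sy z : \sum_uvp z uvp * con uvp ((u, v), (p, q)) =
      z (u, v, p) - z (u, v, q).
    rewrite sum_pair /=.
    transitivity (\sum_uv (uv == (u, v))%:R * \sum_r (inK uv * z (uv, r) *
        ((r == p)%:R - (r == q)%:R))).
      apply: eq_bigr => uv _; rewrite mulr_sumr; apply: eq_bigr => r _.
      rewrite /con /= !(eq_sym _ uv) !(eq_sym _ r); ring.
    rewrite sum_delta inK1.
    under eq_bigr => r _ do rewrite mul1r mulrBr 2![z _ * _]mulrC.
    by rewrite sumrB !sum_delta.
  rewrite sy; under [X in _ + X + _]eq_bigr => r _ do rewrite mulrN.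
  rewrite sumrN sy.
  have -> : \sum_pq y (inr pq) * ((~~ stay pq)%:R * (((p, q) == pq)%:R * inK (u, v)))
      = (~~ stay (p, q))%:R * y (inr (p, q)).
    rewrite inK1 -[RHS](sum_delta (p, q) (fun pq => (~~ stay pq)%:R * y (inr pq))).
    by apply: eq_bigr => pq _; rewrite (eq_sym (p, q)); ring.
  lra.
exists w, phi; split.
- by move=> *; apply: y0.
- move=> u v uK vK i a lti; rewrite -subr_le0.
  apply: le_trans (arc u v _ _ uK vK) _.
  by rewrite /stay /= !inordK ?eqxx ?mul0r // ltnS // ltnW.
- move=> u v uK vK i a b' lti ab; apply: le_trans (arc u v _ _ uK vK) _.
  by rewrite ler_piMl ?y0 // lern1 leq_b1.
have sw : \sum_pq y (inr pq) * (unit_arc pq)%:R =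
    \sum_(i < tau) \sum_a \sum_(b' | adj G a b') w i a b'.
  rewrite sum_pair (@sum_pair _ V 'I_tau.+1) exchange_big big_ord_recr /=.
  rewrite [X in _ + X]big1 ?addr0 => [|a0 _].
    apply: eq_bigr => i _; apply: eq_bigr => a0 _.
    rewrite (@sum_pair _ V 'I_tau.+1) /= [RHS]big_mkcond /=.
    have lti : (i.+1 < tau.+1)%N by rewrite ltnS.
    have wi : widen_ord (leqnSn tau) i = inord i.
      by apply: val_inj; rewrite /= inordK // ltnW.
    apply: eq_bigr => b0 _; rewrite (bigD1 (inord i.+1)) //= big1 => [|j ji].
      by rewrite /unit_arc /w /= inordK // eqxx wi addr0 /=; case: ifP => _;
        rewrite ?mulr1 ?mulr0.
    rewrite /unit_arc /=; case: eqP => [e | _]; last by rewrite mulr0.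
    case/eqP: ji; apply: val_inj.
    by rewrite /= inordK.
  rewrite big1 // => -[b0 j] _; rewrite /unit_arc /=.
  by rewrite ltn_eqF ?mulr0 // ltnS -ltnS ltn_ord.
move: yb; rewrite !big_sumType /= sw.
have sb z : \sum_uvp z uvp * bal uvp = D * \sum_(u in K) \sum_(v in K)
    (z (u, v, (u, ord0)) - z (u, v, (v, ord_max))).
  rewrite sum_pair -sumK mulr_sumr; apply: eq_bigr => -[u v] _ /=.
  transitivity (inK (u, v) * D * (\sum_p (p == src (u, v))%:R * z (u, v, p) -
      \sum_p (p == snk (u, v))%:R * z (u, v, p))).
    rewrite -sumrB mulr_sumr; apply: eq_bigr => p _; rewrite /bal /=; ring.
  by rewrite !sum_delta -mulrA mulrCA.
rewrite sb; under [X in _ + X + _]eq_bigr => r _ do rewrite mulrN.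
rewrite sumrN sb.
have i0 : inord 0 = ord0 :> 'I_tau.+1 by apply: val_inj; rewrite /= inordK.
have im : inord tau = ord_max :> 'I_tau.+1 by apply: val_inj; rewrite /= inordK.
rewrite -mulrN -mulrDr => H.
rewrite -subr_lt0 -mulrN -sumrN addrC; apply: le_lt_trans H.
rewrite lerD2r le_eqVlt; apply/orP; left; apply/eqP; congr (_ * _).
rewrite -sumrN -big_split /=; apply: eq_bigr => u _.
rewrite -!sumrN -big_split /=; apply: eq_bigr => v _.
by rewrite /phi i0 im; ring.
Qed.
End FlowDuality.

(** * Separated sets of terminals *)

Section SeparatedSets.
Variables (V : finType) (near : nat -> rel V) (K : {set V}).
Hypothesis near_refl : forall x, near 0 x x.
Hypothesis near_sym : forall i x y, near i x y -> near i y x.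
Hypothesis near_mono : forall i j x y, (i <= j)%N -> near i x y -> near j x y.
Hypothesis near_trans :
  forall i j x y z, near i x y -> near j y z -> near (i + j) x z.

Definition ball x i := [set y in K | near i x y]%SET.

Definition nbhd (A : {set V}) g := [set y in K | [exists a in A, near g a y]]%SET.

(** If the size more than doubled at each of the [p] radii, the last ball would exceed
    [2 ^ p > #|K|]. *)
Lemma slow_growth (U : {set V}) x g p : U \subset K -> x \in U ->
  (#|K| < 2 ^ p)%N ->
  exists2 i, (i < p)%N &
    (#|ball x (i.+1 * g) :&: U| <= 2 * #|ball x (i * g) :&: U|)%N.
Proof.
move=> UK xU Kp.
case: (pickP (fun i : 'I_p => #|ball x (i.+1 * g) :&: U| <=
    2 * #|ball x (i * g) :&: U|)%N) => [i Hi | H]; first by exists i.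
have grow i : (i <= p)%N -> (2 ^ i <= #|ball x (i * g) :&: U|)%N.
  elim: i => [_ | i IHi lti].
    by rewrite card_gt0; apply/set0Pn; exists x;
       rewrite !inE near_refl xU (subsetP UK).
  have /negbT := H (Ordinal lti); rewrite -ltnNge => /ltnW; apply: leq_trans.
  by rewrite expnS leq_mul2l IHi // ltnW.
have := leq_trans (grow p (leqnn p))
  (subset_leq_card (subset_trans (subsetIr _ U) UK)).
by rewrite leqNgt Kp.
Qed.

Lemma nbhdU A A' g : nbhd (A :|: A') g = nbhd A g :|: nbhd A' g.
Proof.
apply/setP => y; rewrite !inE -andb_orr; congr (_ && _); apply/exists_inP/orP.
  by case=> a /setUP[aA | aA'] n; [left | right]; apply/exists_inP; exists a.
by case=> /exists_inP[a aA n]; exists a; rewrite // inE aA ?orbT.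
Qed.

(* Region growing: while fewer than [#|K| / 8] terminals are collected, add a
   ball, around a terminal outside of the current neighbourhood, at a radius
   where its size less than doubles. *)
Lemma sparse_boundary g p : (#|K| < 2 ^ p)%N ->
    (forall x, x \in K -> 4 * #|ball x (p * g)| < #|K|)%N ->
  exists A : {set V}, [/\ A \subset K, (#|K| <= 8 * #|A|)%N,
    (8 * #|A| <= 3 * #|K|)%N & (#|nbhd A g| <= 2 * #|A|)%N].
Proof.
move=> Kp small.
(* Induction on the number of terminals left out. A ball with fewer than [#|K| / 4] terminals is
   added only while [#|A| < #|K| / 8], so [#|A|] stays within [3 / 8] of [#|K|]. *)
suff grow n : forall A : {set V}, A \subset K -> (#|K| - #|A| <= n)%N ->
    (8 * #|A| <= 3 * #|K|)%N -> (#|nbhd A g| <= 2 * #|A|)%N ->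
    exists A : {set V}, [/\ A \subset K, (#|K| <= 8 * #|A|)%N,
      (8 * #|A| <= 3 * #|K|)%N & (#|nbhd A g| <= 2 * #|A|)%N].
  apply: (grow #|K| finset.set0); rewrite ?sub0set ?cards0 ?subn0 //.
  rewrite leqn0 cards_eq0; apply/eqP/setP => y; rewrite !inE.
  by apply/negP => /andP[_ /exists_inP[a]]; rewrite inE.
elim: n => [|n IHn] A AK An A3 Ag; case: (leqP #|K| (8 * #|A|)) => A8;
  try by exists A.
  move: (subset_leq_card AK); lia.
have : (0 < #|K :\: nbhd A g|)%N.
  move: (cardsID (nbhd A g) K); have -> : K :&: nbhd A g = nbhd A g.
    by apply/setIidPr/subsetP => y; rewrite !inE => /andP[].
  lia.
rewrite card_gt0 => /set0Pn[x xU].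
have xK : x \in K by case/setDP: xU.
have [i ip Hi] := slow_growth g (subsetDl _ _) xU Kp.
set U := K :\: nbhd A g in xU Hi *; set A' := ball x (i * g) :&: U in Hi.
have AA' : [disjoint A & A'].
  rewrite -setI_eq0; apply/eqP/setP => y; rewrite !inE.
  apply/negP => /and4P[yA _ /negP nyA yK]; apply: nyA.
  rewrite yK /=; apply/exists_inP; exists y => //.
  exact: near_mono (leq0n _) (near_refl y).
have cAA' : #|A :|: A'| = (#|A| + #|A'|)%N.
  by rewrite cardsU (eqP (_ : A :&: A' == finset.set0)) ?setI_eq0 // cards0 subn0.
have A'small : (4 * #|A'| < #|K|)%N.
  apply: leq_ltn_trans (small x xK); rewrite leq_mul2l /=.
  apply/subset_leq_card/subsetP => y; rewrite !inE => /andP[/andP[-> xy] _] /=.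
  by apply: near_mono xy; rewrite leq_mul2r (ltnW ip) orbT.
have A'pos : (0 < #|A'|)%N.
  rewrite card_gt0; apply/set0Pn; exists x; rewrite !inE xK in xU *.
  by rewrite xU; rewrite (near_mono (leq0n _) (near_refl x)).
have nb : nbhd (A :|: A') g \subset
    nbhd A g :|: (ball x (i.+1 * g) :&: U).
  rewrite nbhdU; apply/subsetP => y /setUP[yA | ]; first by rewrite inE yA.
  rewrite !inE => /andP[yK /exists_inP[a]]; rewrite !inE.
  move=> /andP[/andP[_ xa] _] ay; rewrite yK /= andbT.
  have -> : near (i.+1 * g) x y by rewrite mulSn addnC; apply: near_trans xa ay.
  exact: orbN.
have := leq_trans (subset_leq_card nb) (leq_card_setU _ _).
move=> nbc; apply: (IHn (A :|: A')); rewrite ?cAA'; try lia.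
by rewrite subUset AK; apply/subsetP => y; rewrite !inE => /andP[/andP[]].
Qed.

(** If a ball of radius [p * g] holds a quarter of the terminals, it is [A], and [B] is the outside
    of the ball of radius [p.+1 * g]: two points of the larger ball are too close to form a pair of
    [F], so every pair has an end in [B]. Otherwise [sparse_boundary] applies. *)
Lemma separated_sets (F : {set V * V}) g p : (#|K| < 2 ^ p)%N ->
    F \subset finset.setX K K ->
    (forall u v, (u, v) \in F -> ~~ near (2 * (p.+1 * g)) u v) ->
  exists A B : {set V}, [/\ A \subset K, B \subset K,
    {in A & B, forall a b, ~~ near g a b},
    (#|F| <= 8 * #|K| * #|A|)%N & (#|F| <= 8 * #|K| * #|B|)%N].
Proof.
move=> Kp FK far.
have F2 : (#|F| <= #|K| * #|K|)%N.
  by rewrite -cardsX; apply: subset_leq_card.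
case: (pickP [pred x in K | #|K| <= 4 * #|ball x (p * g)|]%N) => [x | small].
  move=> /andP[xK big]; exists (ball x (p * g)), (K :\: ball x (p.+1 * g)).
  split; first by apply/subsetP => y; rewrite inE => /andP[].
  - exact: subsetDl.
  - move=> a b; rewrite !inE => /andP[aK xa] /andP[/negP nxb bK].
    apply/negP => ab; apply: nxb; rewrite bK mulSn addnC /=.
    exact: near_trans xa ab.
  - by apply: leq_trans F2 _; nia.
  set B := K :\: _.
  have FB : F \subset finset.setX B K :|: finset.setX K B.
    apply/subsetP => -[u v] uv; have := subsetP FK _ uv.
    rewrite !inE /= => /andP[uK vK]; rewrite uK vK !andbT /=.
    apply/negPn/negP; rewrite negb_or !negbK => /andP[xu xv].
    have := far _ _ uv; rewrite mul2n -addnn => /negP; apply.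
    exact: near_trans (near_sym xu) xv.
  have := leq_trans (subset_leq_card FB) (leq_card_setU _ _).
  rewrite !cardsX; nia.
have [|A [AK A8 A3 Ag]] := @sparse_boundary g p Kp.
  by move=> x xK; have := small x; rewrite /= xK /= ltnNge => ->.
exists A, (K :\: nbhd A g); split=> //; first exact: subsetDl.
- move=> a b aA; rewrite !inE => /andP[/negP nb bK]; apply/negP => ab.
  by apply: nb; rewrite bK /=; apply/exists_inP; exists a.
- by apply: leq_trans F2 _; nia.
- have cB : (#|K :\: nbhd A g| + #|nbhd A g| = #|K|)%N.
    rewrite -[RHS](cardsID (nbhd A g)) addnC; congr (_ + _)%N.
    by apply/eq_card => y; rewrite !inE; case: (y \in K).
  by apply: leq_trans F2 _; nia.
Qed.
End SeparatedSets.

(** * From timed weights to a static length *)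

(** Values up to half the mean contribute at most half of the sum. All values are at most [2 ^ J]
    times half the mean, so the rest is covered by [J] doubling thresholds, one of which accounts
    for a share [1 / (2 * J)] of the sum. *)
Lemma dyadic_level (R : realFieldType) (T : finType) (E : {set T})
    (f : T -> R) J :
  {in E, forall e, 0 <= f e} -> 0 < \sum_(e in E) f e ->
  (2 * #|E| <= 2 ^ J)%N ->
  exists D (F : {set T}), [/\ 0 < D, F \subset E, {in F, forall e, D <= f e} &
    \sum_(e in E) f e <= 4 * J%:R * D * #|F|%:R].
Proof.
set S := \sum_(e in E) f e => f0 S0 EJ.
have E0 : 0 < #|E|%:R :> R.
  rewrite ltr0n card_gt0; apply/eqP => E0.
  by move: S0; rewrite /S E0 big_set0 ltxx.
have J0 : (0 < J)%N.
  by case: J EJ => // EJ; move: E0; rewrite ltr0n; lia.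
pose D0 := S / (2 * #|E|%:R); pose D j := 2 ^+ j * D0.
have D0_gt0 : 0 < D0 by rewrite divr_gt0 ?mulr_gt0.
have D_gt0 j : 0 < D j by rewrite mulr_gt0 ?exprn_gt0.
have SD : S <= D J.
  rewrite /D /D0 mulrCA; apply: ler_peMr; first exact: ltW.
  rewrite ler_pdivlMr ?mulr_gt0 // mul1r.
  by rewrite -natrX -natrM ler_nat.
have pointwise x j : x <= D j ->
    x <= D0 + \sum_(i < j) 2 * D i * (D i <= x)%R%:R.
  elim: j => [|j IHj] xj; first by rewrite big_ord0 addr0 -[D0]mul1r.
  rewrite big_ord_recr /= addrA; case: (leP (D j) x) => Dx.
    rewrite -[x]add0r lerD //; last by rewrite mulr1 mulrA -exprS.
    by rewrite addr_ge0 ?sumr_ge0 ?(ltW D0_gt0) // => i _;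
       rewrite mulr_ge0 ?mulr_ge0 // ltW.
  by rewrite mulr0 addr0 IHj // ltW.
pose c j := #|[set e in E | D j <= f e]%SET|%:R : R.
have Sc : S <= S / 2 + \sum_(j < J) 2 * D j * c j.
  have -> : S / 2 = \sum_(e in E) D0.
    rewrite sumr_const -[RHS]mulr_natr /D0 invfM mulrA mulfVK //.
    by rewrite gt_eqF.
  have -> : \sum_(j < J) 2 * D j * c j =
      \sum_(e in E) \sum_(j < J) 2 * D j * (D j <= f e)%R%:R.
    rewrite exchange_big; apply: eq_bigr => j _; rewrite -mulr_sumr.
    congr (_ * _); rewrite /c -sum1_card natr_sum.
    rewrite [LHS]big_mkcond [RHS]big_mkcond; apply: eq_bigr => e _.
    by rewrite inE; case: (e \in E) => //=; case: ifP.
  rewrite -big_split /=; apply: ler_sum => e eE; apply: pointwise.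
  apply: le_trans SD; rewrite /S (bigD1 e) //= lerDl.
  by apply: sumr_ge0 => i /andP[iE _]; apply: f0.
case: (pickP (fun j : 'I_J => S <= 4 * J%:R * D j * c j)) => [j Hj | H].
  exists (D j), [set e in E | D j <= f e]%SET; split=> //.
    by apply/subsetP => e; rewrite inE => /andP[].
  by move=> e; rewrite inE => /andP[].
have JR : 0 < J%:R :> R by rewrite ltr0n.
have le2 : \sum_(j < J) 2 * D j * c j < S / 2.
  have -> : S / 2 = \sum_(j < J) S / (2 * J%:R).
    rewrite sumr_const card_ord -mulr_natr; field.
    by rewrite gt_eqF.
  apply: ltr_sum => [|j _]; first by apply/hasP; exists (Ordinal J0);
    rewrite ?mem_index_enum.
  have /negbT := H j; rewrite -ltNge => lt.
  rewrite ltr_pdivlMr ?mulr_gt0 //; move: lt; set x := D j; set y := c j.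
  set z := J%:R; lra.
by move: Sc le2; lra.
Qed.

Fixpoint path_sum (T : Type) (S : nmodType) (l : T -> T -> S) x p : S :=
  if p is y :: q then l x y + path_sum l y q else 0.

(** * Potentials along timed walks *)

Section TimedPaths.
Variables (R : realType) (V : finType) (e : rel V) (tau : nat).
Variables (w : nat -> V -> V -> R) (phi : nat -> V -> R).
Hypothesis w_ge0 : forall i a b, 0 <= w i a b.
Hypothesis phi_stay : forall i a, (i < tau)%N -> phi i a <= phi i.+1 a.
Hypothesis phi_arc : forall i a b, (i < tau)%N -> e a b ->
  phi i a - phi i.+1 b <= w i a b.

Fixpoint timed_sum j x p : R :=
  if p is y :: q then w j x y + timed_sum j.+1 y q else 0.

Definition total_weight a b : R := \sum_(0 <= i < tau) w i a b.

Lemma phi_mono i j a : (i <= j)%N -> (j <= tau)%N -> phi i a <= phi j a.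
Proof.
move=> /subnK <-; elim: (j - i)%N => [|m IHm] //= lt.
by apply: le_trans (phi_stay _ lt); apply: IHm; apply: ltnW.
Qed.

Lemma timed_path_bound j x p : path e x p -> (j + size p <= tau)%N ->
  phi 0 x - phi tau (last x p) <= timed_sum j x p.
Proof.
move=> xp le_tau; have lej : (j <= tau)%N by apply: leq_trans le_tau; lia.
apply: le_trans (_ : phi j x - phi tau (last x p) <= _).
  by rewrite lerD2r phi_mono.
elim: p x j xp le_tau {lej} => [|y p IHp] x j /=.
  by rewrite addn0 => _ jt; rewrite subr_le0 phi_mono.
move=> /andP[xy yp]; rewrite addnS => lt; have := IHp y j.+1 yp lt.
have := phi_arc (leq_ltn_trans (leq_addr _ _) lt) xy; lra.
Qed.

(** Different departure times traverse a given step of the walk at different times, so together they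
    pay at most its total weight. *)
Lemma sum_timed_sum c m x p : (c + m + size p <= tau.+1)%N ->
  \sum_(c <= j < c + m) timed_sum j x p <= path_sum total_weight x p.
Proof.
elim: p x c => [|y p IHp] x c /=; first by rewrite big1.
move=> le_tau; rewrite big_split /= lerD //.
  have cm : (c + m <= tau)%N by move: le_tau; lia.
  rewrite /total_weight (big_cat_nat (leq0n c)) /=; last first.
    exact: leq_trans (leq_addr m c) cm.
  rewrite [X in _ + X](big_cat_nat (leq_addr m c) cm) /=.
  rewrite addrCA lerDl addr_ge0 // sumr_ge0 // => i _; exact: w_ge0.
have -> : \sum_(c <= j < c + m) timed_sum j.+1 y p =
    \sum_(c.+1 <= j < c.+1 + m) timed_sum j y p.
  by rewrite addSn big_add1.
by apply: IHp; move: le_tau; lia.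
Qed.

(** The walk can depart at any of the times [0], ..., [m - 1] and still arrive in time; each
    departure pays at least the drop of potential. *)
Lemma static_path_bound m x p : path e x p -> (m + size p <= tau.+1)%N ->
  m%:R * (phi 0 x - phi tau (last x p)) <= path_sum total_weight x p.
Proof.
move=> xp le_tau; apply: le_trans (sum_timed_sum x (c := 0) le_tau).
rewrite add0n mulr_natl -[m in _ *+ m]subn0 -sumr_const_nat.
rewrite big_nat [leRHS]big_nat; apply: ler_sum => j jm.
by apply: timed_path_bound => //; move: jm le_tau; lia.
Qed.
End TimedPaths.

(** * Distances for integer edge lengths *)

Section Nearness.
Variables (V : finType) (e : rel V) (l : V -> V -> nat).
Hypotheses (e_sym : symmetric e) (l_sym : forall a b, l a b = l b a).

Definition near i : rel V := fun x y =>
  `[< exists p, [/\ path e x p, last x p = y & (path_sum l x p <= i)%N] >].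

Lemma near_refl x : near 0 x x.
Proof. by apply/asboolP; exists [::]. Qed.

Lemma near_mono i j x y : (i <= j)%N -> near i x y -> near j x y.
Proof.
move=> ij /asboolP[p [xp xy pi]]; apply/asboolP; exists p; split=> //.
exact: leq_trans ij.
Qed.

Lemma near_trans i j x y z : near i x y -> near j y z -> near (i + j) x z.
Proof.
move=> /asboolP[p [xp xy pi]] /asboolP[q [yq yz qj]]; apply/asboolP.
exists (p ++ q); rewrite cat_path last_cat xy xp; split=> //.
suff -> : path_sum l x (p ++ q) = (path_sum l x p + path_sum l y q)%N.
  exact: leq_add.
by rewrite -xy; elim: p x {xp xy pi} => //= a p IHp x; rewrite IHp addrA.
Qed.

Lemma near_edge x y : e x y -> near (l x y) x y.
Proof. by move=> xy; apply/asboolP; exists [:: y]; rewrite /= xy addr0. Qed.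

Lemma near_sym i x y : near i x y -> near i y x.
Proof.
move=> /asboolP[p [xp <- pi]]; apply: near_mono pi _.
elim: p x xp => [|z p IHp] x /=; first by rewrite near_refl.
move=> /andP[xz zp]; rewrite [(_ + _)%R]addnC.
by apply: near_trans (IHp _ zp) _; rewrite l_sym near_edge // e_sym.
Qed.

(** The distance from [A], cut off at [g.+1], which [find] returns when no radius up to [g]
    suffices. *)
Definition capped_dist (A : {set V}) g v :=
  find (fun i => [exists a in A, near i a v]) (iota 0 g.+1).

Lemma capped_dist_le (A : {set V}) g v : (capped_dist A g v <= g.+1)%N.
Proof. by rewrite /capped_dist -[X in (_ <= X)%N](size_iota 0) find_size. Qed.

Lemma capped_dist_near (A : {set V}) g v i a :
  a \in A -> near i a v -> (capped_dist A g v <= i)%N.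
Proof.
move=> aA ai; case: (leqP g.+1 i) => ig.
  exact: leq_trans (capped_dist_le _ _ _) ig.
rewrite leqNgt; apply/negP => /(before_find 0%N).
by rewrite nth_iota // add0n => /exists_inP[]; exists a.
Qed.

Lemma capped_dist_lip (A : {set V}) g u v :
  e u v -> (capped_dist A g v <= capped_dist A g u + l u v)%N.
Proof.
move=> uv; have := capped_dist_le A g u; rewrite leq_eqVlt => /predU1P[-> |].
  exact: leq_trans (capped_dist_le _ _ _) (leq_addr _ _).
move=> lt; have := lt; rewrite -[X in (_ < X)%N](size_iota 0) -has_find.
move=> /(nth_find 0%N); rewrite nth_iota // add0n => /exists_inP[a aA au].
by apply: (capped_dist_near _ aA); apply: near_trans au (near_edge uv).
Qed.
Lemma capped_dist_far (A : {set V}) g v :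
  {in A, forall a, ~~ near g a v} -> (g < capped_dist A g v)%N.
Proof.
move=> far; rewrite ltnNge; apply/negP => lt; have := lt.
rewrite -ltnS -[X in (_ < X)%N](size_iota 0) -has_find.
move=> /(nth_find 0%N); rewrite nth_iota // add0n => /exists_inP[a aA].
by move=> /(near_mono lt); apply/negP/far.
Qed.
End Nearness.

(** * Moving cuts from infeasible flows *)

Section MovingCut.
Variables (R : realType) (V : finType) (G : sgraph V) (K : {set V}).

(** The two truncated differences add up to [|d a - d b|]: an edge pays, once per direction, for its
    variation beyond 1. *)
Definition cut_cost (d : V -> nat) : nat :=
  (\sum_a \sum_(b | adj G a b) ((d a - d b) + (d b - d a) - 1))%N.

Lemma moving_cut (c : nat) (n' : R) tau : (0 < c)%N -> 0 < n' -> ~ mcf_feasible G K n' tau ->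
  exists (A B : {set V}) (d : V -> nat) beta,
  [/\ A \subset K /\ B \subset K,
      (0 < #|A|)%N /\ (0 < #|B|)%N,
      {in A, forall v, d v = 0%N} /\ {in B, forall v, (beta <= d v)%N},
      (tau.+1 <= 1536 * c * (trunc_log 2 #|K|).+1 ^ 2 * beta)%N &
      (cut_cost d)%:R * c%:R <= n' * #|A|%:R /\
      (cut_cost d)%:R * c%:R <= n' * #|B|%:R].
Proof.
move=> c0 n'0 /mcf_dual[w [phi [w0 stay arc gap]]].
set k := #|K|; set p := (trunc_log 2 k).+1.
have kp : (k < 2 ^ p)%N by rewrite /p trunc_log_ltn.
pose E := finset.setX K K.
pose f (uv : V * V) := Num.max 0 (phi uv.1 uv.2 0%N uv.1 - phi uv.1 uv.2 tau uv.2).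
pose T := \sum_(i < tau) \sum_a \sum_(b | adj G a b) w i a b.
have T0 : 0 <= T.
  by apply: sumr_ge0 => i _; apply: sumr_ge0 => a _; apply: sumr_ge0.
have Tf : T < n' / k%:R * \sum_(uv in E) f uv.
  apply: lt_le_trans gap _; rewrite ler_wpM2l ?divr_ge0 ?ler0n ?(ltW n'0) //.
  rewrite pair_big_dep /=.
  rewrite [leRHS](eq_bigl (fun uv => (uv.1 \in K) && (uv.2 \in K))); last first.
    by move=> uv; rewrite inE.
  by apply: ler_sum => uv _; rewrite le_max lexx orbT.
have k0 : 0 < k%:R :> R.
  rewrite ltr0n lt0n; apply/eqP => k0; move: (le_lt_trans T0 Tf).
  by rewrite k0 invr0 mulr0 mul0r ltxx.
have f0 : 0 < \sum_(uv in E) f uv.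
  by have := le_lt_trans T0 Tf; rewrite pmulr_rgt0 // divr_gt0.
pose J := (2 * p).+1.
have [||D [F [D0 FE Ff fD]]] := dyadic_level _ f0 (J := J).
- by move=> uv _; rewrite le_max lexx.
- by rewrite cardsX /J expnS leq_mul2l /= mul2n -addnn expnD leq_mul // ltnW.
(* A dyadic level carries a fraction [1 / (4 J)] of the total distance and
   [separated_sets] loses a factor [8]; with this scale the total excess length
   is at most [n' * #|X| / c] for both sides [X] of the cut. *)
have [rho rho_def] : exists rho : R, rho = (64 * c%:R * J%:R)^-1 by eexists.
have J0 : 0 < J%:R :> R by rewrite ltr0n.
have cR : 0 < c%:R :> R by rewrite ltr0n.
have cJ0 : 0 < 64 * c%:R * J%:R :> R by rewrite !mulr_gt0 ?ltr0n.
have rho0 : 0 < rho by rewrite rho_def invr_gt0.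
pose W := total_weight tau w.
have W0 a b : 0 <= W a b by apply: sumr_ge0.
(* Rounding down and adding 1 keeps the excess over 1 below the scaled weight, yet a walk has no
   more edges than its length. *)
pose l a b := (Num.truncn (rho / D * (W a b + W b a))).+1.
have l_sym a b : l a b = l b a by rewrite /l addrC.
(* Half of the horizon is reserved for travelling; [m] counts the departure times that remain. *)
pose L := tau./2; pose m := (tau.+1 - L)%N.
pose g := Num.truncn (rho * m%:R / (2 * p.+1%:R)).
have rm0 : 0 <= rho * m%:R / (2 * p.+1%:R).
  by rewrite divr_ge0 ?mulr_ge0 ?ler0n // ltW.
have rho_small : rho * 4 <= 1.
  rewrite rho_def mulrC ler_pdivrMr // mul1r -mulrA.
  apply: (@le_trans _ _ (64 * 1)); first by rewrite mulr1 ler_nat.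
  by rewrite ler_pM2l ?ltr0n // -natrM ler1n muln_gt0 c0.
pose nr := near (adj G) l.
(* A walk of length at most [rho * m] has at most [m / 4] edges, so [static_path_bound] gives it
   weight at least [m * D]. Scaled, this is [rho * m], and rounding makes the length strictly
   larger. *)
have far u v : (u, v) \in F -> ~~ nr (2 * (p.+1 * g))%N u v.
  move=> uvF; have := subsetP FE _ uvF; rewrite inE => /andP[uK vK].
  have fuv := Ff _ uvF; rewrite /f /= in fuv.
  have Dphi : D <= phi u v 0%N u - phi u v tau v.
    move: fuv; rewrite le_max => /orP[|//].
    by move=> /(lt_le_trans D0); rewrite ltxx.
  apply/negP => /asboolP[P [uP Pv lP]].
  have lP' : (path_sum l u P)%:R <= rho * m%:R.
    apply: le_trans (_ : (2 * (p.+1 * g))%:R <= _); first by rewrite ler_nat.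
    have := rm0; rewrite -truncn_le -/g ler_pdivlMr ?mulr_gt0 ?ltr0n //.
    by congr (_ <= _); rewrite !natrM mulrC mulrA.
  have sz : (size P <= path_sum l u P)%N.
    elim: (P) (u) => //= b q IHq a.
    exact: (@leq_add 1 _ (l a b) _ isT (IHq b)).
  have szm : (4 * size P <= m)%N.
    rewrite -(ler_nat R) natrM.
    have : (size P)%:R <= rho * m%:R :> R by apply: le_trans lP'; rewrite ler_nat.
    have := ler_wpM2r (ler0n R m) rho_small; rewrite mul1r => le_m sm.
    apply: le_trans le_m; rewrite mulrAC mulrC.
    by rewrite ler_wpM2r // ler0n.
  have bnd := static_path_bound w0 (stay u v uK vK) (arc u v uK vK) uP
    (m := m).
  have {bnd} := bnd _; rewrite Pv => bnd.
  have {}bnd : m%:R * D <= path_sum W u P.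
    apply: le_trans (bnd _); first by rewrite ler_wpM2l.
    by move: szm; rewrite /m /L; clear; lia.
  have m0 : 0 < m%:R :> R by rewrite ltr0n /m /L; clear; lia.
  have lW a b : rho / D * W a b < (l a b)%:R.
    apply: le_lt_trans (truncnS_gt _); rewrite ler_wpM2l ?lerDl //.
    by rewrite divr_ge0 // ltW.
  have plW x q : rho / D * path_sum W x q <= (path_sum l x q)%:R.
    elim: q x => [|b q IHq] x /=; first by rewrite mulr0.
    by rewrite mulrDr natrD lerD // ltW.
  have : rho / D * path_sum W u P < (path_sum l u P)%:R.
    case: (P) bnd => [|b q] /=; last by rewrite mulrDr natrD => _; rewrite ltr_leD.
    by rewrite leNgt mulr_gt0.
  apply/negP; rewrite -leNgt; apply: le_trans lP' _.
  apply: le_trans (_ : rho / D * (m%:R * D) <= _).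
    by rewrite mulrCA mulfVK ?gt_eqF // mulrC.
  by rewrite ler_wpM2l // divr_ge0 // ltW.
have [A [B [AK BK AB FA FB]]] := separated_sets
  (@near_refl _ _ _) (near_sym (adj_sym G) l_sym)
  (@near_mono _ _ _) (@near_trans _ _ _) kp FE far.
exists A, B, (capped_dist (adj G) l A g), g.+1.
have F0 : (0 < #|F|)%N.
  have c4 : 0 < 4 * J%:R * D by rewrite !mulr_gt0 ?ltr0n.
  rewrite -(ltr0n R) -(pmulr_rgt0 _ c4).
  exact: lt_le_trans f0 fD.
split=> //.
- by split; [move: (leq_trans F0 FA) | move: (leq_trans F0 FB)];
     rewrite muln_gt0 => /andP[].
- split=> v.
    move=> vA; apply/eqP; rewrite -leqn0.
    exact: capped_dist_near vA (near_refl _ _ _).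
  by move=> vB; apply: capped_dist_far => a aA; apply: AB.
- have p0 : (0 < p)%N by [].
  have m2 : (tau.+1 <= 2 * m)%N by rewrite /m /L; clear; lia.
  have := truncnS_gt (rho * m%:R / (2 * p.+1%:R)); rewrite -/g.
  rewrite ltr_pdivrMr ?mulr_gt0 ?ltr0n // rho_def mulrC ltr_pdivrMr //.
  rewrite -!natrM ltr_nat /J => lt.
  have {lt m2} : (tau.+1 <= 2 * (g.+1 * (2 * p.+1) * (64 * c * (2 * p).+1)))%N.
    by apply: leq_trans m2 _; rewrite leq_mul2l ltnW.
  move=> /leq_trans; apply.
  (* This [6], times the [256] collected from [m], [g] and [rho], is the [1536] of the statement. *)
  have le : (p.+1 * (2 * p).+1 <= 6 * p ^ 2)%N.
    by move: (p) p0; clear => q q0; rewrite -mulnn; nia.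
  have := leq_mul le (leqnn (g.+1 * (256 * c))).
  move: (p) (g) (c) (J); clear => q h b j; lia.
(* Along an edge the capped distance varies by at most [l], and [l - 1] is at most the scaled weight
   of both directions; hence the factor 2. *)
have cost : (cut_cost (capped_dist (adj G) l A g))%:R <= 2 * (rho / D) * T.
  have sumW : \sum_a \sum_(b | adj G a b) W a b = T.
    rewrite /T [RHS]exchange_big; apply: eq_bigr => a _.
    by rewrite [RHS]exchange_big; apply: eq_bigr => b _; rewrite /W /total_weight big_mkord.
  have -> : 2 * (rho / D) * T =
      \sum_a \sum_(b | adj G a b) rho / D * (W a b + W b a).
    under [RHS]eq_bigr => a _ do rewrite -mulr_sumr big_split /=.
    rewrite -mulr_sumr big_split /= sumW.
    have -> : \sum_a \sum_(b | adj G a b) W b a = T.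
      rewrite -sumW (exchange_big_dep xpredT) //=; apply: eq_bigr => b _.
      by apply: eq_bigl => a; rewrite adj_sym.
    by ring.
  rewrite natr_sum; apply: ler_sum => a _; rewrite natr_sum.
  apply: ler_sum => b ab; apply: le_trans (_ : (l a b).-1%:R <= _); last first.
    by rewrite truncn_le mulr_ge0 ?addr_ge0 // divr_ge0 // ltW.
  have := capped_dist_lip l A g ab.
  have ba : adj G b a by rewrite adj_sym.
  have := capped_dist_lip l A g ba; rewrite (l_sym b a) ler_nat.
  rewrite /l /=; set t := Num.truncn _; set x := capped_dist _ _ _ _ _.
  set y := capped_dist _ _ _ _ _; clear; lia.
have bnd (X : {set V}) : (#|F| <= 8 * k * #|X|)%N ->
   (cut_cost (capped_dist (adj G) l A g))%:R * c%:R <= n' * #|X|%:R.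
  move=> FX; apply: le_trans (_ : 2 * (rho / D) * T * c%:R <= _).
    by rewrite ler_wpM2r.
  have FX' : #|F|%:R <= 8 * k%:R * #|X|%:R :> R by rewrite -!natrM ler_nat.
  apply: le_trans (_ : 2 * (rho / D) *
    (n' / k%:R * (4 * J%:R * D * (8 * k%:R * #|X|%:R))) * c%:R <= _).
    have rD : 0 <= 2 * (rho / D) by rewrite mulr_ge0 ?divr_ge0 // ltW.
    have nk : 0 <= n' / k%:R by rewrite divr_ge0 ?ler0n // ltW.
    have JD : 0 <= 4 * J%:R * D by rewrite !mulr_ge0 ?ler0n // ltW.
    apply: ler_wpM2r => //; apply: ler_wpM2l => //.
    apply: ltW; apply: (lt_le_trans Tf); apply: ler_wpM2l => //.
    by apply: (le_trans fD); apply: ler_wpM2l.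
  rewrite le_eqVlt; apply/orP; left; apply/eqP; rewrite rho_def; field.
  by rewrite !gt_eqF.
by split; apply: bnd.
Qed.
End MovingCut.

(** * Two-party simulation *)

Lemma card_ord_itv n a b : (#|[set i : 'I_n | a <= i < b]%SET| <= b - a)%N.
Proof.
rewrite cardE -(size_map val) -[(b - a)%N](size_iota a).
apply: uniq_leq_size; first by rewrite map_inj_uniq ?enum_uniq //; apply: val_inj.
move=> j /mapP[i]; rewrite mem_enum inE mem_iota => ab ->; move: ab; rewrite /=; lia.
Qed.

(* At round [i] the first party knows the nodes at depth less than [beta - i]
   and the second party those at depth more than [i]; together they know
   everything, and only bits on edges that the shrinking regions skip over have
   to be exchanged. *)
Section Simulation.
Variables (V : finType) (G : sgraph V) (I : Type) (Pi : protocol V I).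
Variables (X Y : Type) (inp : X -> Y -> V -> I) (d : V -> nat) (beta t : nat).
Hypothesis beta_gt0 : (0 < beta)%N.
Hypothesis t_small : (2 * t <= beta)%N.
Hypothesis inp_fst :
  forall x y y' v, (d v < beta)%N -> inp x y v = inp x y' v.
Hypothesis inp_snd :
  forall x x' y v, (0 < d v)%N -> inp x y v = inp x' y v.

(** The bits that one party needs but cannot compute: [u] has left its region by round [i], while
    [v] is still in it at round [i.+1]. The first disjunct is for the region [d v + i < beta] of the
    first party, the second for the region [i < d v] of the second. *)
Definition crossing : {set V * V * 'I_t} :=
  [set c : V * V * 'I_t | adj G c.1.1 c.1.2 &&
     ((beta - d c.1.1 <= c.2 < beta - d c.1.2 - 1) ||
      (d c.1.1 <= c.2 < d c.1.2 - 1))%N]%SET.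

Definition sent x y i u v := send Pi u (inp x y u) (received G Pi (inp x y) i u) v.

(** Recording the messages that carry a 1 leaves at most [2 ^ #|crossing|] transcripts. *)
Definition transcript x y : {set V * V * 'I_t} :=
  [set c : V * V * 'I_t in crossing | sent x y c.2 c.1.1 c.1.2]%SET.

Lemma in_transcript x y c : (c \in transcript x y) =
  (c \in crossing) && sent x y c.2 c.1.1 c.1.2.
Proof. by rewrite in_set. Qed.

(** Induction on the round: on the mixed input the first region evolves as on [(x, y)] and the
    second as on [(x', y')]. As [2 * t <= beta], every sender lies in one of the regions; if it is
    not in the region of the receiver, its bit is a crossing message, on which the two transcripts
    agree. *)
Lemma transcript_cut_paste x y x' y' : transcript x y = transcript x' y' ->
  forall i, (i <= t)%N -> forall v,
  ((d v + i < beta)%N ->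
     received G Pi (inp x y') i v = received G Pi (inp x y) i v) /\
  ((i < d v)%N ->
     received G Pi (inp x y') i v = received G Pi (inp x' y') i v).
Proof.
move=> tr; elim=> [|i IHi] lt v //=.
have {}IHi := IHi (ltnW lt).
have sent_eq u : (u, v, Ordinal lt) \in crossing ->
    sent x y i u v = sent x' y' i u v.
  move=> uvC; have /setP/(_ (u, v, Ordinal lt)) := tr.
  by rewrite !in_transcript uvC.
have fst_eq u : (d u + i < beta)%N -> sent x y' i u v = sent x y i u v.
  move=> ui; rewrite /sent (IHi u).1 // (inp_fst x y' y) //.
  exact: leq_ltn_trans (leq_addr _ _) ui.
have snd_eq u : (i < d u)%N -> sent x y' i u v = sent x' y' i u v.
  move=> ui; rewrite /sent (IHi u).2 // (inp_snd x x') //.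
  exact: leq_ltn_trans ui.
split=> vi; congr rcons.
- by apply: (IHi v).1; lia.
- apply/ffunP => u; rewrite !ffunE; case uv: (adj G u v) => //=.
  rewrite -/(sent x y' i u v) -/(sent x y i u v).
  case: (ltnP (d u + i) beta) => ui; first exact: fst_eq.
  rewrite snd_eq; last by lia.
  by rewrite sent_eq // inE /= uv; apply/orP; left; lia.
- by apply: (IHi v).2; lia.
- apply/ffunP => u; rewrite !ffunE; case uv: (adj G u v) => //=.
  rewrite -/(sent x y' i u v) -/(sent x' y' i u v).
  case: (ltnP i (d u)) => ui; first exact: snd_eq.
  rewrite fst_eq; last by lia.
  by rewrite sent_eq // inE /= uv; apply/orP; right; lia.
Qed.

Lemma transcript_rectangle x y x' y' : transcript x y = transcript x' y' ->
  transcript x y' = transcript x y /\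
  forall v, d v = 0%N ->
    answer G Pi (inp x y') t v = answer G Pi (inp x y) t v.
Proof.
move=> tr; have cp := transcript_cut_paste tr; split=> [|v dv].
  apply/setP => -[[u v] i]; rewrite !in_transcript /=.
  case uvC: (_ \in crossing) => //=; have le_it := ltnW (ltn_ord i).
  case: (ltnP (d u + i) beta) => ui.
    rewrite /sent (cp i le_it u).1 // (inp_fst x y' y) //.
    exact: leq_ltn_trans (leq_addr _ _) ui.
  transitivity (sent x' y' i u v).
    have di : (i < d u)%N by move: (ltn_ord i); lia.
    rewrite /sent (cp i le_it u).2 // (inp_snd x x') //.
    exact: leq_ltn_trans di.
  have /setP/(_ (u, v, i)) := tr.
  by rewrite !in_transcript uvC.
by rewrite /answer (cp t (leqnn t) v).1 ?(inp_fst x y' y) ?dv //; lia.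
Qed.

(** For a given arc only one disjunct can hold, depending on which end is deeper, and it leaves at
    most [|d u - d v| - 1] rounds. *)
Lemma card_crossing : (#|crossing| <= cut_cost G d)%N.
Proof.
rewrite /cut_cost pair_big_dep /= -sum1_card.
rewrite (partition_big fst (fun uv => adj G uv.1 uv.2)) /=; last first.
  by move=> c; rewrite inE => /andP[].
apply: leq_sum => -[u v] uv; rewrite sum1_card.
case: (leqP (d u) (d v)) => duv.
  apply: leq_trans (_ : #|[set i : 'I_t | d u <= i < d v - 1]%SET| <= _)%N.
    rewrite -(card_imset _ (f := fun i : 'I_t => (u, v, i))); last by move=> i j [].
    apply: subset_leq_card; apply/subsetP => -[uv' i] uvi.
    have {uvi} : ((uv', i) \in crossing) && (uv' == (u, v)) := uvi; rewrite in_set /=.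
    case/andP => /andP[_ /orP[/andP[H1 H2]|H]] /eqP e; subst uv'.
      by exfalso; move: H1 H2 => /=; lia.
    by apply/imsetP; exists i; rewrite // inE.
  by apply: leq_trans (card_ord_itv _ _ _) _ => /=; lia.
apply: leq_trans (_ : #|[set i : 'I_t | beta - d u <= i < beta - d v - 1]%SET| <= _)%N.
  rewrite -(card_imset _ (f := fun i : 'I_t => (u, v, i))); last by move=> i j [].
  apply: subset_leq_card; apply/subsetP => -[uv' i] uvi.
  have {uvi} : ((uv', i) \in crossing) && (uv' == (u, v)) := uvi; rewrite in_set /=.
  case/andP => /andP[_ /orP[H|/andP[H1 H2]]] /eqP e; subst uv'; last first.
    by exfalso; move: H1 H2 => /=; lia.
  by apply/imsetP; exists i; rewrite // inE.
by apply: leq_trans (card_ord_itv _ _ _) _ => /=; lia.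
Qed.
End Simulation.

(** * Discrepancy of the inner product *)

Section Discrepancy.
Variables (R : realType) (m : nat).
Notation X := {ffun 'I_m -> bool}.

Definition ip_sign (x y : X) : R := \prod_i (-1) ^+ (x i && y i).

(** Cauchy-Schwarz against the constant 1, by expanding the double sum of [(a i - a j) ^+ 2]. *)
Lemma sum_sq_le (T : finType) (a : T -> R) :
  (\sum_i a i) ^+ 2 <= #|T|%:R * \sum_i a i ^+ 2.
Proof.
have : 0 <= \sum_i \sum_j (a i - a j) ^+ 2.
  by apply: sumr_ge0 => i _; apply: sumr_ge0 => j _; apply: sqr_ge0.
have -> : \sum_i \sum_j (a i - a j) ^+ 2 =
    2 * (#|T|%:R * \sum_i a i ^+ 2) - 2 * (\sum_i a i) ^+ 2.
  transitivity (\sum_i (#|T|%:R * a i ^+ 2 + \sum_j a j ^+ 2 -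
      2 * a i * \sum_j a j)).
    apply: eq_bigr => i _.
    have -> : #|T|%:R * a i ^+ 2 = \sum_(j : T) a i ^+ 2.
      by rewrite sumr_const mulr_natl.
    rewrite mulr_sumr -big_split -sumrB /=; apply: eq_bigr => j _; ring.
  rewrite sumrB big_split /= -mulr_sumr sumr_const -mulr_suml -mulr_sumr.
  rewrite -[in X in _ + X - _]mulr_natl; ring.
lra.
Qed.

(** The sum factors over coordinates, and one where [y] and [y'] differ contributes [1 - 1 = 0]. *)
Lemma ip_sign_orthogonal (y y' : X) :
  \sum_x ip_sign x y * ip_sign x y' = 2 ^+ m * (y == y')%:R.
Proof.
under eq_bigr => x _ do rewrite -big_split /=.
pose F i b : R := (-1) ^+ (b && y i) * (-1) ^+ (b && y' i).
rewrite -(bigA_distr_bigA F).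
have [e | yy'] := eqVneq y y'.
  subst y'; rewrite mulr1 (eq_bigr (fun=> 2)) ?prodr_const ?card_ord // => i _.
  rewrite big_bool /= /F -expr2 sqrr_sign !mulr1; ring.
rewrite mulr0; have /existsP[i yi] : [exists i, y i != y' i].
  apply: contraNT yy' => /existsPn H; apply/eqP/ffunP => i.
  by have := H i; rewrite negbK => /eqP.
rewrite (bigD1 i) //= big_bool /F /=; move: yi; case: (y i); case: (y' i) => //= _;
  rewrite ?expr0 ?expr1 ?mulr1 ?mul1r addNr mul0r //.
Qed.

Lemma ip_sign_parseval (g : X -> R) :
  \sum_x (\sum_y g y * ip_sign x y) ^+ 2 = 2 ^+ m * \sum_y g y ^+ 2.
Proof.
transitivity (\sum_y \sum_y' g y * g y' * \sum_x ip_sign x y * ip_sign x y').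
  under eq_bigr => x _ do rewrite expr2 mulr_suml.
  rewrite exchange_big; apply: eq_bigr => y _.
  under eq_bigr => x _ do rewrite mulr_sumr.
  rewrite exchange_big; apply: eq_bigr => y' _.
  by rewrite mulr_sumr; apply: eq_bigr => x _; ring.
rewrite mulr_sumr; apply: eq_bigr => y _.
rewrite (bigD1 y) //= ip_sign_orthogonal eqxx mulr1 big1 => [|y' ne].
  by rewrite addr0 mulrC expr2.
by rewrite ip_sign_orthogonal eq_sym (negPf ne) !mulr0.
Qed.

(** Of the three factors [2 ^+ m] in [8 ^+ m], one comes from Cauchy-Schwarz over [x], one from
    Parseval and one from the square norm of [g]. *)
Lemma lindsey (f g : X -> R) :
  (forall x, f x ^+ 2 <= 1) -> (forall y, g y ^+ 2 <= 1) ->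
  \sum_x \sum_y f x * g y * ip_sign x y <= Num.sqrt (8 ^+ m).
Proof.
move=> f1 g1; apply: le_trans (ler_norm _) _; rewrite -sqrtr_sqr ler_wsqrtr //.
have cX : #|{: X}| = (2 ^ m)%N by rewrite card_ffun card_bool card_ord.
apply: le_trans (sum_sq_le _) _; rewrite cX natrX.
apply: le_trans (_ : 2 ^+ m * \sum_x (\sum_y g y * ip_sign x y) ^+ 2 <= _).
  rewrite ler_wpM2l ?exprn_ge0 //; apply: ler_sum => x _.
  have -> : \sum_y f x * g y * ip_sign x y = f x * \sum_y g y * ip_sign x y.
    by rewrite mulr_sumr; apply: eq_bigr => y _; rewrite mulrA.
  by rewrite exprMn ler_piMl ?sqr_ge0.
rewrite ip_sign_parseval mulrA -exprMn.
have -> : 8 = 2 * 2 * 2 :> R by ring.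
rewrite [leRHS]exprMn ler_wpM2l ?exprn_ge0 // -natrX -cX -sum1_card natr_sum.
exact: ler_sum.
Qed.

(** The inputs with a given transcript form a rectangle on which the answer depends on [x] alone.
    Its sides give [f] and [g], the sign of the answer being absorbed in [f], and [lindsey] bounds
    each rectangle. *)
Lemma ip_communication (U : finType) (C : {set U}) (tr : X -> X -> {set U})
    (ans : X -> X -> bool) :
  (forall x y, tr x y \subset C) ->
  (forall x y x' y', tr x y = tr x' y' ->
     tr x y' = tr x y /\ ans x y' = ans x y) ->
  \sum_x \sum_y (-1) ^+ ans x y * ip_sign x y <=
    2 ^+ #|C| * Num.sqrt (8 ^+ m).
Proof.
move=> trC rect.
pose f S x : R := if [pick y | tr x y == S] is Some y then (-1) ^+ ans x y else 0.
pose g S y : R := [exists x, tr x y == S]%:R.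
have split_tr x y : (-1) ^+ ans x y * ip_sign x y =
    \sum_(S in powerset C) f S x * g S y * ip_sign x y.
  rewrite (bigD1 (tr x y)) ?inE //= big1 => [|S /andP[_ neS]].
    rewrite addr0; congr (_ * _); rewrite /f /g.
    case: pickP => [y' /eqP e | /(_ y)]; last by rewrite eqxx.
    have -> : [exists x', tr x' y == tr x y] by apply/existsP; exists x.
    by rewrite mulr1; have [_ ->] := rect _ _ _ _ e.
  rewrite /f /g; case: pickP => [y' /eqP e | _]; last by rewrite !mul0r.
  case: existsP => [[x' /eqP e'] | _]; last by rewrite mulr0 mul0r.
  case/eqP: neS; have [] := rect x y' x' y; first by rewrite e e'.
  by move=> -> _; rewrite e.
under eq_bigr => x _.
  under eq_bigr => y _ do rewrite split_tr.
  rewrite exchange_big /=; over.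
rewrite exchange_big /=.
apply: le_trans (_ : \sum_(S in powerset C) Num.sqrt (8 ^+ m) <= _).
  apply: ler_sum => S _; apply: lindsey => [x | y].
    by rewrite /f; case: pickP => [y _|_]; rewrite ?sqrr_sign // expr0n.
  by rewrite /g; case: [exists _, _]; rewrite ?expr1n // expr0n.
by rewrite sumr_const card_powerset -[_ *+ (2 ^ _)]mulr_natl natrX.
Qed.

End Discrepancy.

(** * The hard input graphs *)

Section HardGraph.
Variable g : nat.
Notation Q := (8 * g + 7)%N.
Definition vertex : finType := ('I_Q.+1 * (bool * bool))%type.
Notation N := #|vertex|.
Notation rk := (@enum_rank vertex).

(* Commuting the two involutions [b += x] and [a += b] of [F_2^2] adds [x y] to
   [a]; the even positions that carry no step separate the two parties. *)
Definition local_step (x y : bool) r (t : bool * bool) : bool * bool :=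
  match r with
  | 0 | 4 => (t.1, t.2 (+) x)
  | 2 | 6 => (t.1 (+) (y && t.2), t.2)
  | _ => t
  end%N.

Definition step (x y : nat -> bool) j :=
  local_step (x (j %/ 8)%N) (y (j %/ 8)%N) (j %% 8)%N.

(** Every vertex but [root] indexes one edge. After column 0 it is the track edge to the previous
    column. In column 0, two indices give edges joining the tracks 00, 01 and 10 there, and 11 gives
    the edge between the tracks 00 and 01 of the last column. *)
Definition endpoints x y (v : vertex) : vertex * vertex :=
  if v.1 != ord0 then ((inord v.1.-1, step x y v.1.-1 v.2), v) else
  match v.2 with
  | (false, true) => ((ord0, (false, false)), v)
  | (true, false) => ((ord0, (false, true)), v)
  | _ => ((ord_max, (false, false)), (ord_max, (false, true)))
  end.

Definition hard_edge x y v : {set 'I_N} :=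
  [set rk (endpoints x y v).1; rk (endpoints x y v).2]%SET.

Definition root : vertex := (ord0, (false, false)).

Definition hard_edges x y : {set {set 'I_N}} :=
  [set hard_edge x y v | v in [set~ root]]%SET.

Lemma stepK x y j : involutive (step x y j).
Proof.
case=> a b; rewrite /step /local_step.
by case: (j %% 8)%N => [|[|[|[|[|[|[|r]]]]]]] //=; rewrite -addbA addbb addbF.
Qed.

Lemma endpoints_neq x y v : (endpoints x y v).1 != (endpoints x y v).2.
Proof.
case: v => j [a b]; rewrite /endpoints /=; case: ifP => [v0 | /negbFE/eqP] /=.
  have jpos : (0 < j)%N by rewrite lt0n.
  rewrite xpair_eqE negb_and -(inj_eq val_inj) /= inordK ?neq_ltn.
    by rewrite prednK // leqnn.
  by rewrite (leq_trans _ (ltn_ord j)) // ltnS leq_pred.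
by move->; case: a b => [] []; rewrite xpair_eqE ?andbF.
Qed.

Lemma hard_edges_card2 x y : [forall e in hard_edges x y, #|e| == 2%N].
Proof.
apply/forall_inP => e /imsetP[v _ ->].
by rewrite cards2 (inj_eq enum_rank_inj) endpoints_neq.
Qed.

Definition hard_graph x y : sgraph 'I_N := SGraph (hard_edges_card2 x y).

Lemma set2_inj (T : finType) (a b c d : T) : [set a; b]%SET = [set c; d]%SET ->
  (a, b) = (c, d) \/ (a, b) = (d, c).
Proof.
move=> /setP e; have := e a; have := e b; have := e c; have := e d.
rewrite !inE !eqxx ?orbT /=.
case: (eqVneq a c) => [->|_]; case: (eqVneq b d) => [->|_]; rewrite ?eqxx ?orbT /=;
  try by left.
all: do ?[case: eqP => [?|_] //=; subst]; rewrite ?eqxx ?orbT //=; auto.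
Qed.

(** A track edge joins consecutive columns and is indexed by its later end; the extra edges stay
    within one column. *)
Lemma hard_edge_inj x y : {in [set~ root] &, injective (hard_edge x y)}.
Proof.
have posP (v : vertex) : v.1 != ord0 ->
    ((endpoints x y v).1.1.+1 = (endpoints x y v).2.1 :> nat) /\
    (endpoints x y v).2 = v.
  move=> v0; rewrite /endpoints v0 /=; split=> //.
  have vpos : (0 < v.1)%N by rewrite lt0n.
  by rewrite inordK ?prednK // (leq_trans _ (ltn_ord v.1)) // ltnS leq_pred.
have flat (v : vertex) : v.1 = ord0 ->
    (endpoints x y v).1.1 = (endpoints x y v).2.1 :> nat.
  by case: v => j [a b] /= ->; rewrite /endpoints eqxx; case: a b => [] [].
move=> v v'; rewrite !inE => vr vr' /set2_inj e.
have {e} : endpoints x y v = endpoints x y v' \/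
    endpoints x y v = ((endpoints x y v').2, (endpoints x y v').1).
  by case: e => -[/enum_rank_inj e1 /enum_rank_inj e2]; [left | right];
    apply/eqP; rewrite [endpoints x y v]surjective_pairing e1 e2 ?xpair_eqE
      ?eqxx // -surjective_pairing.
have [v0|v0] := eqVneq v.1 ord0; have [v0'|v0'] := eqVneq v'.1 ord0.
- case: v v' v0 v0' vr vr' => j [a b] [j' [a' b']] /= -> ->.
  rewrite !xpair_eqE !eqxx /= /endpoints eqxx /=.
  case: a; case: b; case: a'; case: b' => //= _ _ [] [] //;
    try by move=> *; lia.
- have [e1 e2] := posP _ v0'; have := flat _ v0.
  by move=> f0 [] e; move: f0 e1; rewrite e /= => ->; lia.
- have [e1 e2] := posP _ v0; have := flat _ v0'.
  by move=> f0 [] e; move: f0 e1; rewrite e /= => ->; lia.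
- have [e1 e2] := posP _ v0; have [e1' e2'] := posP _ v0'.
  case=> e; first by rewrite -e2 e e2'.
  by move: e1 e1'; rewrite e /=; lia.
Qed.

Lemma card_hard_graph x y : #|edge_set (hard_graph x y)| = N.-1.
Proof. by rewrite card_in_imset ?cardsC1 //; apply: hard_edge_inj. Qed.

Fixpoint back x y j t :=
  if j is i.+1 then back x y i (step x y i t) else t.

Definition parity (x y : nat -> bool) i := \big[addb/false]_(0 <= i' < i) (x i' && y i').

Lemma back_add x y i r t : (r < 8)%N ->
  back x y (8 * i + r.+1)%N t = back x y (8 * i + r)%N (local_step (x i) (y i) r t).
Proof.
move=> r8; rewrite addnS -[LHS]/(back x y (8 * i + r) (step x y (8 * i + r) t)).
by rewrite /step mulnC divnMDl // modnMDl divn_small // addn0 modn_small.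
Qed.

Lemma back_block x y i t : back x y (8 * i)%N t = (t.1 (+) parity x y i, t.2).
Proof.
elim: i t => [|i IHi] [a b]; first by rewrite muln0 /parity big_nil /= addbF.
rewrite mulnS addnC 8?back_add // addn0 IHi /parity big_nat_recr //=.
by case: (x i) (y i) a b (\big[_/_]_(_ <= _ < _) _) => [] [] [] [] [].
Qed.

(** [Q] falls one short of whole blocks, but the last position of a block carries no step. *)
Lemma back_last x y t : back x y Q t = (t.1 (+) parity x y g.+1, t.2).
Proof. by rewrite -back_block mulnS (addnC 8) [RHS]back_add. Qed.

Definition label x y (w : 'I_N) := let v := enum_val w : vertex in back x y v.1 v.2.

Lemma label_edge x y (v : vertex) : (0 < v.1)%N ->
  label x y (rk (endpoints x y v).1) = label x y (rk (endpoints x y v).2).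
Proof.
move=> v0; rewrite /endpoints -val_eqE /= -lt0n v0 /label !enum_rankK /=.
by rewrite inordK ?(leq_ltn_trans (leq_pred _)) // -[in RHS](prednK v0).
Qed.

Lemma hard_edge_adj x y v : v != root ->
  adj (hard_graph x y) (rk (endpoints x y v).1) (rk (endpoints x y v).2).
Proof. by move=> vr; apply/imsetP; exists v; rewrite ?inE. Qed.

Definition in_top3 x y w := label x y w != (true, true).

Lemma adj_in_top3 x y : ~~ parity x y g.+1 -> forall v w,
  adj (hard_graph x y) v w -> in_top3 x y v = in_top3 x y w.
Proof.
move=> par v w /imsetP[u]; rewrite in_setC1 => ur e.
suff {v w e} : in_top3 x y (rk (endpoints x y u).1) =
    in_top3 x y (rk (endpoints x y u).2).
  by case: (set2_inj e) => -[-> ->].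
rewrite /in_top3; have [u0|u0] := posnP u.1; last by rewrite label_edge.
case: u u0 ur => j [a b] /= j0; have {j0}-> : j = ord0 by apply: val_inj.
rewrite /endpoints eqxx /label; case: a b => [] [] //= _; rewrite !enum_rankK //=.
by rewrite !back_last (negPf par).
Qed.

Lemma connect_top x y v :
  connect (adj (hard_graph x y)) (rk v) (rk (ord0, label x y (rk v))).
Proof.
rewrite /label enum_rankK; case: v => j t /=.
have [n jn] : exists n : nat, n = j :> nat by exists j.
elim: n j t jn => [|n IHn] j t jn.
  have -> : j = ord0 by apply: val_inj.
  exact: connect0.
have nQ : (n < Q.+1)%N by rewrite (leq_trans _ (ltn_ord j)) // -jn.
apply: connect_trans (_ : connect _ _ (rk (inord n, step x y n t))) _.
  rewrite (sym_connect_sym (adj_sym (hard_graph x y))); apply: connect1.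
  have jt : (j, t) != root.
    by rewrite xpair_eqE negb_and -(inj_eq val_inj) /= -jn.
  have := hard_edge_adj x y jt; rewrite /endpoints /=.
  by rewrite -(inj_eq val_inj) /= -jn.
rewrite -jn /=; have := IHn (inord n) (step x y n t).
by rewrite inordK //; apply.
Qed.

(** Every vertex is connected to its track in column 0, where only 11 is not yet joined to the
    others. Traced back to column 0, the edge of the last column joins 10 to 11 if the parity is 1,
    and merely 00 to 01 if it is 0. *)
Lemma hard_graph_connected x y :
  connected_graph (hard_graph x y) = parity x y g.+1.
Proof.
set E := adj (hard_graph x y); have csym := sym_connect_sym (adj_sym (hard_graph x y)).
apply/idP/idP => [/forallP con | par].
  apply/negPn/negP => par.
  have /forallP/(_ (rk (ord0, (true, true)))) := con (rk root).
  have clos : fingraph.closed E (in_top3 x y).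
    by move=> u v; apply: adj_in_top3.
  move=> /(closed_connect clos).
  by rewrite unfold_in [RHS]unfold_in /in_top3 /label !enum_rankK.
pose top t := rk (ord0, t) : 'I_N.
have c01 : connect E (top (false, false)) (top (false, true)).
  exact/connect1/(hard_edge_adj x y (v := (ord0, (false, true)))).
have c12 : connect E (top (false, true)) (top (true, false)).
  exact/connect1/(hard_edge_adj x y (v := (ord0, (true, false)))).
have c23 : connect E (top (true, false)) (top (true, true)).
  have := hard_edge_adj x y (v := (ord0, (true, true))) isT.
  move=> /connect1 c; have := connect_top x y (ord_max, (false, false)).
  have := connect_top x y (ord_max, (false, true)).
  rewrite /label !enum_rankK !back_last par /= => c' c''.
  by apply: connect_trans c'; apply: connect_trans c; rewrite csym.
have c0 t : connect E (top (false, false)) (top t).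
  case: t => [] [] [] //; first exact: connect_trans c01 (connect_trans c12 c23).
  exact: connect_trans c01 c12.
apply/forallP => u; apply/forallP => v.
have tops w : connect E w (top (label x y w)).
  by have := connect_top x y (enum_val w); rewrite enum_valK.
apply: connect_trans (tops u) _; rewrite csym; apply: connect_trans (tops v) _.
by apply: connect_trans (c0 _); rewrite csym.
Qed.

End HardGraph.

(** * Distribution of the hard inputs *)

Section Owners.
Variables (g : nat) (V : finType) (alpha beta : nat -> V).
Notation Q := (8 * g + 7)%N.
Notation N := #|vertex g|.

(** In each block [alpha] owns columns 0, 1, 4, 5 and [beta] owns 2, 3, 6, 7, so both ends of an
    edge that depends on an input bit belong to the owner of that bit. *)
Definition owner (w : 'I_N) : V :=
  let v := enum_val w : vertex g in
  if odd (v.1 %% 8)./2 then beta (v.1 %/ 8)%N else alpha (v.1 %/ 8)%N.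

Lemma local_step_owner (j : 'I_Q.+1) (t : bool * bool) x y x' y' :
  (0 < j)%N -> step x y j.-1 t != step x' y' j.-1 t ->
  (x (j.-1 %/ 8)%N != x' (j.-1 %/ 8)%N /\
     forall t', owner (enum_rank (j, t)) = alpha (j.-1 %/ 8)%N /\
       owner (enum_rank (inord j.-1, t') : 'I_N) = alpha (j.-1 %/ 8)%N) \/
  (y (j.-1 %/ 8)%N != y' (j.-1 %/ 8)%N /\
     forall t', owner (enum_rank (j, t)) = beta (j.-1 %/ 8)%N /\
       owner (enum_rank (inord j.-1, t') : 'I_N) = beta (j.-1 %/ 8)%N).
Proof.
move=> j0.
have lt : (j.-1 < Q.+1)%N by rewrite (leq_ltn_trans (leq_pred _)).
have jE : j = (8 * (j.-1 %/ 8) + (j.-1 %% 8).+1)%N :> nat.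
  by have := divn_eq j.-1 8; lia.
set i := (j.-1 %/ 8)%N in jE *; set r := (j.-1 %% 8)%N in jE *.
have dm s : (s < 8)%N -> ((8 * i + s) %/ 8 = i)%N /\ ((8 * i + s) %% 8 = s)%N.
  by move=> s8; rewrite mulnC divnMDl // modnMDl divn_small // addn0 modn_small.
have own t' : owner (enum_rank (inord j.-1, t') : 'I_N) =
    if odd r./2 then beta i else alpha i.
  by rewrite /owner enum_rankK /= inordK.
have ownj : owner (enum_rank (j, t)) =
    if odd ((8 * i + r.+1) %% 8)./2 then beta ((8 * i + r.+1) %/ 8)%N
    else alpha ((8 * i + r.+1) %/ 8)%N.
  by rewrite /owner enum_rankK /= jE.
have r8 : (r < 8)%N by rewrite ltn_mod.
rewrite ownj /step -/i -/r.
case: r r8 own {jE ownj} => [|[|[|[|[|[|[|[|r]]]]]]]] // _ own;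
  rewrite /local_step ?eqxx // => ne; [left | right | left | right];
  (split=> [|t']; first by apply: contraNneq ne => ->); rewrite own.
- by have [-> ->] := dm 1%N isT.
- by have [-> ->] := dm 3%N isT.
- by have [-> ->] := dm 5%N isT.
- by have [-> ->] := dm 7%N isT.
Qed.

(** An edge that changes depends on a changed bit, so both its ends are owned within [B]. *)
Lemma hard_edges_local (B : {set V}) x y x' y' e w :
  (forall i, x i != x' i -> alpha i \in B) ->
  (forall i, y i != y' i -> beta i \in B) ->
  e \in hard_edges g x y -> w \in e -> owner w \notin B ->
  e \in hard_edges g x' y'.
Proof.
move=> xB yB /imsetP[v vr ->] we wB; apply/imsetP; exists v => //.
rewrite /hard_edge; suff -> : endpoints x' y' v = endpoints x y v by [].
rewrite /endpoints; case: ifP => // v0; congr (_, _); congr (_, _).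
apply/eqP; apply: contraR wB; rewrite eq_sym => ne.
have v0' : (0 < v.1)%N by rewrite lt0n.
move: we; rewrite /hard_edge /endpoints v0 !inE /=.
case: v v0 v0' ne {vr} => j t /= _ j0 ne.
case: (local_step_owner j0 ne) => -[ne' own] /orP[] /eqP->;
  rewrite ?(own (step x y j.-1 t)).1 ?(own (step x y j.-1 t)).2;
  by [apply: xB | apply: yB].
Qed.

(** An edge at a vertex is indexed by that vertex, by its successor on the track or by one of three
    indices in column 0. *)
Lemma deg_hard_graph x y w : (deg (hard_graph g x y) w <= 5)%N.
Proof.
pose v := enum_val w : vertex g.
pose S : seq (vertex g) := [:: v; (inord v.1.+1, step x y v.1 v.2);
  (ord0, (false, true)); (ord0, (true, false)); (ord0, (true, true))].
apply: leq_trans (_ : #|[set hard_edge x y u | u in S]%SET| <= _)%N; last first.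
  by apply: leq_trans (leq_imset_card _ _) (card_size _).
apply/subset_leq_card/subsetP => e; rewrite inE => /andP[/imsetP[u ur ->] wu].
apply: imset_f; move: wu; rewrite !inE /endpoints.
have -> : w = enum_rank v by rewrite enum_valK.
have [u0|u0] := eqVneq u.1 ord0.
  by case: u u0 ur => j [[] []] /= -> ur _; rewrite ?eqxx ?orbT //;
    move: ur; rewrite !inE /root eqxx.
rewrite /= !(inj_eq enum_rank_inj) => /orP[/eqP vE | /eqP ->]; last by rewrite eqxx.
apply/orP; right; apply/orP; left; apply/eqP.
have u1 : (0 < u.1)%N by rewrite lt0n.
rewrite vE /= inordK ?(leq_ltn_trans (leq_pred _)) // prednK // stepK inord_val.
by case: (u).
Qed.

Lemma max_deg_hard_graph x y : (0 < max_deg (hard_graph g x y))%N.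
Proof.
pose v : vertex g := (ord0, (false, true)).
apply: leq_trans (leq_bigmax (enum_rank v)); rewrite /deg card_gt0.
apply/set0Pn; exists (hard_edge x y v); rewrite inE; apply/andP; split.
  by apply: imset_f; rewrite !inE.
by rewrite !inE eqxx orbT.
Qed.

Lemma card_owner u : (#|[set w | owner w == u]%SET| <=
  32 * (#|[set i : 'I_g.+1 | alpha i == u]%SET| +
        #|[set i : 'I_g.+1 | beta i == u]%SET|))%N.
Proof.
set S1 := [set i | alpha _ == u]%SET; set S2 := [set i | beta _ == u]%SET.
pose blk (w : 'I_N) : 'I_g.+1 * 'I_8 * (bool * bool) :=
  let v := enum_val w : vertex g in
  (inord (v.1 %/ 8), inord (v.1 %% 8), v.2).
have blt (j : 'I_Q.+1) : (j %/ 8 < g.+1)%N.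
  by rewrite ltn_divLR // (leq_trans (ltn_ord j)) //; lia.
have blk_inj : injective blk.
  move=> w w' [] /(congr1 val) /= e1 /(congr1 val) /= e2 e3.
  rewrite !inordK ?ltn_mod // in e1 e2; apply: enum_val_inj.
  move: e1 e2 e3; case: (enum_val w) => j t; case: (enum_val w') => j' t' /=.
  move=> e1 e2 ->; congr (_, _); apply: val_inj.
  by rewrite /= (divn_eq j 8) e1 e2 -divn_eq.
rewrite -(card_imset _ blk_inj).
apply: leq_trans (_ : #|finset.setX (finset.setX (S1 :|: S2) [set: 'I_8]%SET)
    [set: bool * bool]%SET| <= _)%N.
  apply/subset_leq_card/subsetP => z /imsetP[w]; rewrite inE => /eqP wu ->.
  rewrite !inE /= !andbT inordK // -wu /owner /=.
  by case: ifP; rewrite eqxx ?orbT.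
rewrite !cardsX !cardsT card_ord card_prod card_bool.
have : (#|S1 :|: S2| <= #|S1| + #|S2|)%N by rewrite leq_card_setU.
lia.
Qed.
End Owners.

Lemma round_robin (V : finType) (A : {set V}) : (0 < #|A|)%N ->
  exists2 f : nat -> V, (forall i, f i \in A) &
    forall m n u, (#|[set i : 'I_m | (i < n) && (f i == u)]%SET| <= n %/ #|A| + 1)%N.
Proof.
move=> A0; have [u0 _] : exists u, u \in A by apply/set0Pn; rewrite -card_gt0.
have ltA i : (i %% #|A| < size (enum A))%N by rewrite -cardE ltn_mod.
exists (fun i => nth u0 (enum A) (i %% #|A|)).
  by move=> i; rewrite -mem_enum mem_nth.
move=> m n u; set S := [set i | _]%SET.
rewrite cardE -(size_map (fun i : 'I_m => i %/ #|A|)%N) -(size_iota 0 (_ + 1)).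
apply: uniq_leq_size.
  rewrite map_inj_in_uniq ?enum_uniq // => i j; rewrite !mem_enum !inE.
  move=> /andP[_ /eqP iu] /andP[_ /eqP ju] e; apply: val_inj => /=.
  rewrite (divn_eq i #|A|) (divn_eq j #|A|) e; congr (_ + _)%N.
  by apply/eqP; rewrite -(nth_uniq u0 (ltA i) (ltA j)) ?enum_uniq // iu ju.
move=> q /mapP[i]; rewrite mem_enum inE => /andP[lt _] ->.
by rewrite mem_iota add0n addn1 ltnS leq_div2r // ltnW.
Qed.

(** * Lower bound on the number of rounds *)

(** Success probability [2 / 3] means correlation at least [1 / 3] with [ip_sign] on every input.
    Averaged over the coins, this contradicts the bound of [ip_communication] on the total
    correlation of each deterministic protocol. *)
Lemma rounds_lower_bound (R : realType) (V : finType) (G : sgraph V)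
    (K : {set V}) (N M m : nat) (D : input_family V N)
    (inp : {ffun 'I_m -> bool} -> {ffun 'I_m -> bool} -> distribution V N)
    (H : {ffun 'I_m -> bool} -> {ffun 'I_m -> bool} -> sgraph 'I_N)
    (d : V -> nat) (beta : nat) (a : V) :
  (forall x y, D (inp x y) (H x y)) ->
  (forall x y, #|edge_set (H x y)| = M) ->
  (forall x y, (-1) ^+ connected_graph (H x y) = ip_sign R x y) ->
  (forall x y y' v, (d v < beta)%N -> inp x y v = inp x y' v) ->
  (forall x x' y v, (0 < d v)%N -> inp x y v = inp x' y v) ->
  (0 < beta)%N -> a \in K -> d a = 0%N -> (2 * cut_cost G d + 4 <= m)%N ->
  forall (Omega : finType) (P : Omega -> R)
    (Pi : Omega -> protocol V {set {set 'I_N}}) (t : nat),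
    (forall w, 0 <= P w) -> \sum_w P w = 1 ->
    solves_connectivity G K M P Pi t D -> (beta < 2 * t)%N.
Proof.
move=> DH HM Hsign inp1 inp2 beta0 aK da dm Omega P Pi t P0 P1 solves.
rewrite ltnNge; apply/negP => t_small.
pose X := {ffun 'I_m -> bool}.
pose ans w x y := answer G (Pi w) (inp x y) t a.
pose b := cut_cost G d.
have upper w : \sum_x \sum_y (-1) ^+ ans w x y * ip_sign R x y <=
    2 ^+ b * Num.sqrt (8 ^+ m).
  apply: le_trans (@ip_communication R m _ (crossing G d beta t)
    (transcript G (Pi w) inp d beta t) (ans w) _ _) _.
  - by move=> x y; apply/subsetP => c; rewrite inE => /andP[].
  - move=> x y x' y' e.
    have [e1 e2] := transcript_rectangle beta0 t_small inp1 inp2 e.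
    by split=> //; apply: e2.
  - rewrite ler_wpM2r ?sqrtr_ge0 // ler_eXn2l ?ltr1n //.
    exact: card_crossing.
have lower x y :
    3^-1 <= \sum_w P w * ((-1) ^+ ans w x y * ip_sign R x y).
  have sol := solves _ _ (DH x y) (HM x y).
  apply: le_trans (_ : 2 * (\sum_(w | [forall u in K,
      answer G (Pi w) (inp x y) t u == connected_graph (H x y)]) P w) - \sum_w P w <= _).
    rewrite P1; move: sol; lra.
  rewrite big_mkcond mulr_sumr -sumrB; apply: ler_sum => w _.
  rewrite -Hsign; case: ifP => [/forall_inP/(_ a aK)/eqP e | _].
    by rewrite /ans e -expr2 sqrr_sign; lra.
  rewrite mulr0 sub0r -[- P w]mulrN1 ler_wpM2l // -signr_addb.
  by case: addb; rewrite ?expr0 ?expr1 // lerN10.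
have : 2 ^+ m * 2 ^+ m * 3^-1 <= 2 ^+ b * Num.sqrt (8 ^+ m) :> R.
  have cX : \sum_(x : X) (1 : R) = 2 ^+ m.
    by rewrite sumr_const card_ffun card_bool card_ord natrX.
  apply: le_trans (_ : \sum_x \sum_y
      \sum_w P w * ((-1) ^+ ans w x y * ip_sign R x y) <= _).
    rewrite -cX -mulrA mulr_suml; apply: ler_sum => x _; rewrite mul1r.
    rewrite mulr_suml; apply: ler_sum => y _; rewrite mul1r; exact: lower.
  under eq_bigr => x _ do rewrite exchange_big.
  have -> : 2 ^+ b * Num.sqrt (8 ^+ m) =
      \sum_w P w * (2 ^+ b * Num.sqrt (8 ^+ m)).
    by rewrite -mulr_suml P1 mul1r.
  rewrite exchange_big; apply: ler_sum => w _.
  under eq_bigr => x _ do rewrite -mulr_sumr.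
  by rewrite -mulr_sumr; apply: ler_wpM2l (upper w).
rewrite ler_pdivrMr ?ltr0n // => le1.
have : (2 ^+ m * 2 ^+ m) ^+ 2 <= (2 ^+ b * Num.sqrt (8 ^+ m) * 3) ^+ 2 :> R.
  by rewrite lerXn2r // nnegrE ?mulr_ge0 ?exprn_ge0 ?sqrtr_ge0.
rewrite !exprMn sqr_sqrtr ?exprn_ge0 //.
have -> : 8 ^+ m = 2 ^+ m * 2 ^+ m * 2 ^+ m :> R by rewrite -!exprMn; congr (_ ^+ _); ring.
(* The 4 spare bits supply the factor 16, which beats the [3 ^+ 2] left by squaring. *)
have zb : 16 * (2 ^+ b) ^+ 2 <= 2 ^+ m :> R.
  have -> : 16 = 2 ^+ 4 :> R by ring.
  by rewrite -exprM -exprD ler_eXn2l ?ltr1n // addnC mulnC.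
have key (z c : R) : 0 < z -> 0 < c -> 16 * c <= z ->
    ~ z ^+ 2 * z ^+ 2 <= c * (z * z * z) * 3 ^+ 2.
  clear; move=> z0 c0 zc; apply/negP; rewrite -ltNge.
  have -> : z ^+ 2 * z ^+ 2 = z * (z * z * z) by ring.
  have -> : c * (z * z * z) * 3 ^+ 2 = 9 * c * (z * z * z) by ring.
  by rewrite ltr_pM2r ?mulr_gt0 //; lra.
by apply: key zb; rewrite !exprn_gt0.
Qed.

(** * The hard instance of a moving cut *)

Definition bits m (x : {ffun 'I_m -> bool}) (i : nat) : bool :=
  if insub i is Some j then x j else false.

Lemma bits_neq m (x x' : {ffun 'I_m -> bool}) i :
  bits x i != bits x' i -> (i < m)%N.
Proof. by rewrite /bits; case: insubP => //= _; rewrite eqxx. Qed.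

(** Positions from [m] on read [false], so blocks used as padding leave the parity unchanged. *)
Lemma parity_bits (R : realType) m g (x y : {ffun 'I_m -> bool}) : (m <= g)%N ->
  (-1) ^+ parity (bits x) (bits y) g = ip_sign R x y.
Proof.
move=> mg; rewrite /parity (big_cat_nat (leq0n m) mg) /=.
have -> : \big[addb/false]_(m <= i < g) (bits x i && bits y i) = false.
  rewrite big_nat big1 // => i /andP[mi _].
  by rewrite /bits insubF // ltnNge mi.
rewrite addbF big_mkord (big_morph (fun b : bool => (-1) ^+ b : R) (id1 := 1)
  (op1 := *%R)) //; last by move=> b b'; rewrite signr_addb.
by apply: eq_bigr => i _; rewrite /bits valK.
Qed.

Lemma card_node_distribution (V : finType) N (s : 'I_N -> V) (H : sgraph 'I_N) u :
  (#|node_distribution s H u| <= \sum_(w | s w == u) deg H w)%N.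
Proof.
have -> : (\sum_(w | s w == u) deg H w =
    \sum_(e in edge_set H) \sum_(w | (s w == u) && (w \in e)) 1)%N.
  rewrite (exchange_big_dep (fun w => s w == u)) /=; last first.
    by move=> e w _ /andP[].
  apply: eq_bigr => w sw; rewrite /deg -sum1_card.
  by apply: eq_bigl => e; rewrite inE sw.
rewrite -sum1_card [X in (_ <= X)%N](bigID (fun e => e \in node_distribution s H u)) /=.
apply: leq_trans (leq_addr _ _).
rewrite (eq_bigl (fun e => (e \in edge_set H) && (e \in node_distribution s H u))).
  apply: leq_sum => e /andP[eH]; rewrite inE => /andP[_ /exists_inP[w we sw]].
  by rewrite (bigD1 w) ?sw.
by move=> e; rewrite inE andbA andbb.
Qed.

Lemma card_vertex g : #|vertex g| = (32 * g.+1)%N.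
Proof. by rewrite !card_prod card_ord card_bool; lia. Qed.

Section HardInstance.
Variables (R : realType) (V : finType) (G : sgraph V) (K : {set V}).
Variables (n c : nat) (C : R) (A B : {set V}) (d : V -> nat) (beta : nat).
Notation N := #|vertex (n + 3)|.
Notation M := N.-1.
Hypotheses (n_gt0 : (0 < n)%N) (c_large : (640 <= c)%N) (C_large : 3200%:R <= C).
Hypotheses (AK : A \subset K) (BK : B \subset K).
Hypotheses (A_gt0 : (0 < #|A|)%N) (B_gt0 : (0 < #|B|)%N).
Hypothesis dA : {in A, forall v, d v = 0%N}.
Hypothesis dB : {in B, forall v, (beta <= d v)%N}.
Hypothesis beta_gt0 : (0 < beta)%N.
Hypothesis costA :
  (cut_cost G d)%:R * c%:R <= (M%:R + N%:R) / #|K|%:R * #|A|%:R :> R.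
Hypothesis costB :
  (cut_cost G d)%:R * c%:R <= (M%:R + N%:R) / #|K|%:R * #|B|%:R :> R.

Lemma hard_instance : exists2 s : 'I_N -> V, (forall w, s w \in K) &
  forall D : input_family V N,
  D = node_inputs K C s \/ D = @edge_inputs R V K N C ->
  forall (Omega : finType) (P : Omega -> R)
    (Pi : Omega -> protocol V {set {set 'I_N}}) (t : nat),
    (forall w, 0 <= P w) -> \sum_w P w = 1 ->
    solves_connectivity G K M P Pi t D -> (beta < 2 * t)%N.
Proof.
(* Of the [n + 4] blocks, [m] carry input bits, which fit because [q <= k]. The added 4 is the slack
   that [rounds_lower_bound] asks for. *)
pose k := #|K|; pose q := minn #|A| #|B|; pose m := ((n * q) %/ k + 4)%N.
have q0 : (0 < q)%N by rewrite leq_min A_gt0.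
have qk : (q <= k)%N.
  by apply: leq_trans (subset_leq_card AK); apply: geq_minl.
have k0 : (0 < k)%N by apply: leq_trans qk.
have mn : (m <= n + 4)%N.
  rewrite /m leq_add2r; apply: leq_trans (leq_div2r k (leq_mul (leqnn n) qk)) _.
  by rewrite mulnK.
have NE : N = (32 * (n + 4))%N by rewrite card_vertex -addnS.
(* [M + N <= 64 * (n + 4) <= 320 * n], and [c] is at least twice 320. *)
have cost : (2 * cut_cost G d + 4 <= m)%N.
  have cq (X : nat) : (cut_cost G d)%:R * c%:R <= (M%:R + N%:R) / k%:R * X%:R :> R ->
      (2 * cut_cost G d * k <= n * X)%N.
    rewrite mulrAC ler_pdivlMr ?ltr0n // -natrD -!natrM ler_nat NE => le.
    have le' : (640 * (cut_cost G d * k) <= c * (cut_cost G d * k))%N.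
      by rewrite leq_mul2r c_large orbT.
    have le'' : (320 * n * X >= (64 * (n + 4)) * X)%N.
      by rewrite leq_mul2r; apply/orP; right; move: n_gt0; clear; lia.
    move: le le' le''; set z := cut_cost G d; clear; nia.
  rewrite /m leq_add2r leq_divRL // /q.
  by case: (leqP #|A| #|B|) => _; apply: cq.
have [fA fAA fAn] := round_robin A_gt0.
have [fB fBB fBn] := round_robin B_gt0.
have [fK fKK fKn] := round_robin k0.
(* Blocks with input bits are dealt to [A] and [B]; padding is dealt to all of [K] to keep the load
   balanced. *)
pose alpha i := if (i < m)%N then fA i else fK i.
pose beta' i := if (i < m)%N then fB i else fK i.
have alphaK i : alpha i \in K.
  by rewrite /alpha; case: ifP => // _; apply: (subsetP AK).
have betaK i : beta' i \in K.
  by rewrite /beta'; case: ifP => // _; apply: (subsetP BK).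
pose s : 'I_N -> V := owner alpha beta'.
have sK w : s w \in K by rewrite /s /owner /=; case: ifP.
exists s => //.
pose H (x y : {ffun 'I_m -> bool}) := hard_graph (n + 3) (bits x) (bits y).
have HM x y : #|edge_set (H x y)| = M by apply: card_hard_graph.
have Hsign x y : (-1) ^+ connected_graph (H x y) = ip_sign R x y.
  by rewrite hard_graph_connected parity_bits // -addnS.
pose nd x y := node_distribution s (H x y).
have nd_fst x y y' v : (d v < beta)%N -> nd x y v \subset nd x y' v.
  move=> dv; apply/subsetP => e; rewrite inE => /andP[eH].
  move=> /exists_inP[w we /eqP sw]; rewrite inE; apply/andP; split; last first.
    by apply/exists_inP; exists w; rewrite ?sw.
  apply: (hard_edges_local (alpha := alpha) (beta := beta') (B := B) _ _ eH we).
  - by move=> i; rewrite eqxx.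
  - by move=> i /bits_neq im; rewrite /beta' im.
  - by rewrite -/(s w) sw; apply/negP => /dB; rewrite leqNgt dv.
have nd_snd x x' y v : (0 < d v)%N -> nd x y v \subset nd x' y v.
  move=> dv; apply/subsetP => e; rewrite inE => /andP[eH].
  move=> /exists_inP[w we /eqP sw]; rewrite inE; apply/andP; split; last first.
    by apply/exists_inP; exists w; rewrite ?sw.
  apply: (hard_edges_local (alpha := alpha) (beta := beta') (B := A) _ _ eH we).
  - by move=> i /bits_neq im; rewrite /alpha im.
  - by move=> i; rewrite eqxx.
  - by rewrite -/(s w) sw; apply/negP => /dA dv0; rewrite dv0 in dv.
have nd_fst_eq x y y' v : (d v < beta)%N -> nd x y v = nd x y' v.
  by move=> dv; apply/eqP; rewrite eqEsubset !nd_fst.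
have nd_snd_eq x x' y v : (0 < d v)%N -> nd x y v = nd x' y v.
  by move=> dv; apply/eqP; rewrite eqEsubset !nd_snd.
(* Each of [alpha] and [beta'] gives a terminal at most [2 * n / k + 10] blocks. The two together,
   times 32 vertices per block and degree 5, make [640] and [3200]. *)
have load x y u :
    (k * \sum_(w | s w == u) deg (H x y) w <= 640 * n + 3200 * k)%N.
  have share (X : {set V}) : (q <= #|X|)%N -> (k * (m %/ #|X|) <= n + 4 * k)%N.
    move=> qX; rewrite -(leq_pmul2r q0).
    have h1 : (m %/ #|X| * q <= m)%N.
      by apply: leq_trans (leq_trunc_div m #|X|); rewrite leq_mul2l qX orbT.
    have h2 := leq_trunc_div (n * q) k.
    move: h1 h2 q0; rewrite {2}/m; move: (m %/ #|X|)%N (n * q %/ k)%N; clear.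
    nia.
  have shareK : (k * ((n + 4) %/ k) <= n + 4 * k)%N.
    apply: leq_trans (_ : n + 4 <= _)%N; first by rewrite mulnC leq_trunc_div.
    by move: k0; clear; lia.
  have fiber (f : nat -> V) (X : {set V}) (al : nat -> V) : (q <= #|X|)%N ->
      (forall m n (u : V), (#|[set i : 'I_m | (i < n) && (f i == u)]%SET|
         <= n %/ #|X| + 1)%N) ->
      al =1 (fun i => if (i < m)%N then f i else fK i) ->
      (k * #|[set i : 'I_(n + 3).+1 | al i == u]%SET| <= 2 * n + 10 * k)%N.
    move=> qX fX alE.
    have sub : [set i : 'I_(n + 3).+1 | al i == u]%SET \subset
        [set i : 'I_(n + 3).+1 | (i < m)%N && (f i == u)]%SET :|:
        [set i : 'I_(n + 3).+1 | (i < n + 4)%N && (fK i == u)]%SET.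
      apply/subsetP => i; rewrite !inE alE.
      have -> : (i < n + 4)%N by rewrite (leq_trans (ltn_ord i)) // -addnS.
      by case: ifP => _ ->; rewrite ?orbT.
    have := leq_trans (subset_leq_card sub) (leq_card_setU _ _).
    have := fX (n + 3).+1 m u; have := fKn (n + 3).+1 (n + 4)%N u; rewrite -/k.
    have := share X qX; move: shareK.
    move: #|[set i : 'I_(n + 3).+1 | al i == u]%SET| #|_| #|_|.
    move: ((n + 4) %/ k)%N (m %/ #|X|)%N k0; clear; nia.
  have fa := fiber fA A alpha (geq_minl _ _) fAn (fun=> erefl).
  have fb := fiber fB B beta' (geq_minr _ _) fBn (fun=> erefl).
  have own := @card_owner (n + 3) V alpha beta' u.
  have sd : (\sum_(w | s w == u) deg (H x y) w <= 5 * #|[set w | s w == u]%SET|)%N.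
    rewrite -sum1_card big_distrr /=.
    rewrite (eq_bigl (fun w => w \in [set w | s w == u]%SET)); last first.
      by move=> w; rewrite inE.
    by apply: leq_sum => w _; rewrite muln1; apply: deg_hard_graph.
  move: fa fb own sd; rewrite /s.
  move: (\sum_(w | _) _)%N #|_| #|_| #|_|; clear; nia.
have bal x y u : (\sum_(w | s w == u) deg (H x y) w)%N%:R <= balance K C (H x y).
  have : (k * \sum_(w | s w == u) deg (H x y) w <= 3200 * (M + k * max_deg (H x y)))%N.
    apply: leq_trans (load x y u) _.
    have := max_deg_hard_graph (n + 3) (bits x) (bits y); rewrite -/(H x y).
    by move: (max_deg (H x y)) => D0 D0_gt0; rewrite NE; move: k0 D0_gt0; clear; nia.
  rewrite -(ler_nat R) !(natrM, natrD) /balance HM -/k.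
  have kR : 0 < k%:R :> R by rewrite ltr0n.
  set S := (\sum_(w | _) _)%N; set D := max_deg _ => le.
  have -> : C * (M%:R / k%:R + D%:R) = C * (M%:R + k%:R * D%:R) / k%:R.
    by rewrite -mulrA mulrDl [k%:R * _]mulrC mulfK // gt_eqF.
  rewrite ler_pdivlMr // mulrC; apply: le_trans le _.
  by rewrite ler_wpM2r // addr_ge0 ?mulr_ge0 ?ler0n.
have [a aA] : exists a, a \in A by apply/set0Pn; rewrite -card_gt0.
have aK := subsetP AK _ aA.
move=> D DE Omega P Pi t P0 P1 solves.
(* For the edge distribution, an edge goes to the owner of one chosen end; [a] is the default for
   the empty set. *)
pose pk (e : {set 'I_N}) := if [pick w in e] is Some w then s w else a.
pose ed x y u := [set e in nd x y u | pk e == u]%SET.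
have inH x y u e : (e \in ed x y u) = (e \in edge_set (H x y)) && (pk e == u).
  rewrite !inE -andbA; apply: andb_id2l => eH; apply: andb_idl.
  have : e != finset.set0.
    by have /forall_inP/(_ _ eH) := edge_setP (H x y); rewrite -card_gt0 => /eqP->.
  rewrite /pk => e0; case: pickP => [w we /eqP sw|none]; last first.
    by case/set0Pn: e0 => w; have := none w; rewrite /= => ->.
  by apply/exists_inP; exists w; rewrite ?sw.
case: DE => DE; subst D.
- apply: (rounds_lower_bound (inp := nd) (H := H) _ HM Hsign _ _ beta_gt0 aK
    (dA aA) cost P0 P1 solves).
  + by move=> x y; split=> // u _; apply: bal.
  + exact: nd_fst_eq.
  + exact: nd_snd_eq.
- apply: (rounds_lower_bound (inp := ed) (H := H) _ HM Hsign _ _ beta_gt0 aK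
    (dA aA) cost P0 P1 solves).
  + move=> x y; split; last first.
      move=> u _; apply: le_trans (bal x y u); rewrite ler_nat.
      apply: leq_trans (card_node_distribution _ _ _).
      by apply: subset_leq_card; apply/subsetP => e; rewrite !inE => /andP[].
    split; last first.
      move=> u v _ _ uv; rewrite -setI_eq0; apply/eqP/setP => e.
      rewrite in_setI !inH inE; apply/negP => /andP[/andP[_ /eqP e1] /andP[_ /eqP e2]].
      by rewrite -e1 -e2 eqxx in uv.
    have pkK e : pk e \in K by rewrite /pk; case: pickP.
    split=> [u uK|].
      apply/setP => e; rewrite inH inE; apply/negP => /andP[_ /eqP e'].
      by rewrite -e' pkK in uK.
    apply/setP => e; apply/bigcupP/idP => [[u _]|eH]; first by rewrite inH => /andP[].
    by exists (pk e) => //; rewrite inH eH eqxx.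
  + by move=> x y y' v dv; rewrite /ed (nd_fst_eq _ _ y').
  + by move=> x x' y v dv; rewrite /ed (nd_snd_eq _ x').
Qed.
End HardInstance.

(** * From infeasible horizons to the bound on rounds *)

Lemma tau_MCF_le (R : realType) (V : finType) (G : sgraph V) (K : {set V})
    (n' eps : R) (t : nat) : 0 < eps ->
  (forall tau, ~ mcf_feasible G K n' tau -> eps * tau.+1%:R <= t%:R) ->
  (eps%:E * tau_MCF G K n' <= t%:R%:E)%E.
Proof.
(* At this horizon [eps * tau.+1] exceeds [t], so the flow is feasible and [tau] bounds the
   infimum. *)
move=> eps0 infeas; pose tau := Num.truncn (t%:R / eps).
have te0 : 0 <= t%:R / eps by rewrite divr_ge0 ?ler0n // ltW.
have feas : mcf_feasible G K n' tau.
  apply: contrapT => /infeas; rewrite leNgt mulrC -ltr_pdivrMr //.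
  by rewrite truncnS_gt.
apply: le_trans (_ : eps%:E * tau%:R%:E <= _)%E.
  rewrite lee_pmul2l //; apply: ereal_inf_lbound.
  by exists tau.
by rewrite -EFinM lee_fin mulrC -ler_pdivlMr // truncn_le.
Qed.

(** Makes the node assignment independent of the horizon. If every [x] failed at some index [f x], a
    witness for the largest such index would, by monotonicity, be good at its own failing index. *)
Lemma exists_uniform_witness (T : finType) (Good : T -> nat -> Prop)
    (Q : nat -> Prop) (x0 : T) :
  (forall x i j, (i <= j)%N -> Good x j -> Good x i) ->
  (forall i, Q i -> exists x, Good x i) ->
  exists x, forall i, Q i -> Good x i.
Proof.
move=> mono good; apply: contrapT => none.
have bad x : exists i, Q i /\ ~ Good x i.
  apply: contrapT => nx; apply: none; exists x => i Qi.
  by apply: contrapT => nG; apply: nx; exists i.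
have [f Hf] := choice bad.
case: (@arg_maxnP T x0 xpredT f isT) => x _ fx.
have [y Gy] := good _ (Hf x).1.
by case: (Hf y).2; apply: mono Gy; apply: fx.
Qed.

Lemma ln_nat_bounds (R : realType) (k : nat) (z : R) : (0 < k)%N ->
  k%:R + 2 <= z -> 0 < ln z /\ (trunc_log 2 k).+1%:R <= 4 * ln z.
Proof.
move=> k0 kz; set p := trunc_log 2 k.
have half : 2^-1 <= ln 2 :> R.
  have := @le_ln1Dx R (- 2^-1); rewrite (_ : 1 + - 2^-1 = 2^-1); last by lra.
  rewrite lnV ?posrE //; move=> /(_ _); lra.
have kR : 0 <= k%:R :> R by [].
have ln2 : ln 2 <= ln z by rewrite ler_ln ?posrE //; lra.
have lnk : p%:R * ln 2 <= ln z.
  rewrite mulr_natl -lnXn // ler_ln ?posrE ?exprn_gt0 //; last by lra.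
  by rewrite -natrX; apply: le_trans (_ : k%:R <= _);
     [rewrite ler_nat trunc_logP | lra].
split; first by lra.
have := ler_wpM2l (ler0n R p) half.
have -> : p.+1%:R = p%:R + 1 :> R by rewrite -natr1.
move: lnk half ln2; clear; lra.
Qed.

Lemma requires_rounds_sub (R : realType) (V : finType) (G : sgraph V)
    (K : {set V}) N M (D D' : input_family V N) (b : \bar R) :
  (forall x H, D x H -> D' x H) ->
  requires_rounds G K M D b -> requires_rounds G K M D' b.
Proof.
move=> DD' req Omega P Pi t P0 P1 sol; apply: (req Omega P Pi t P0 P1).
by move=> x H /DD'; apply: sol.
Qed.

Theorem theorem6p9 (R : realType) :
  exists (c C : R) (a : nat), 0 < c /\ 0 < C /\
  forall (V : finType) (G : sgraph V) (K : {set V}), K != set0 ->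
  forall n : nat,
  exists N M : nat,
    (n <= N + M)%N /\ (N + M)%:R <= C * n%:R /\
    let k : R := #|K|%:R in
    let bound : \bar R :=
      ((c / ln (k + N%:R + M%:R + 2) ^+ a)%:E
         * tau_MCF G K ((M%:R + N%:R) / k))%E in
    [/\ requires_rounds G K M (@any_inputs V K N) bound,
        exists2 s : 'I_N -> V, (forall w, s w \in K)
          & requires_rounds G K M (node_inputs K C s) bound
      & requires_rounds G K M (@edge_inputs R V K N C) bound].
Proof.
have [c c640] : exists c, (640 <= c)%N by exists 640%N.
have [C C3200] : exists C : R, 3200%:R <= C by exists 3200%:R.
have C0 : 0 < C by apply: lt_le_trans C3200; rewrite ltr0n.
(* [3072] is the [1536] of [moving_cut] doubled by [beta < 2 * t]; [16] is the square of the 4 in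
   [ln_nat_bounds]. *)
pose cc : R := 3072 * c%:R * 16.
have cc0 : 0 < cc by rewrite !mulr_gt0 ?ltr0n // (leq_trans _ c640).
exists cc^-1, C, 2%N; split; first by rewrite invr_gt0.
split=> // V G K K0 n; rewrite -card_gt0 in K0.
have [u0 u0K] : exists u, u \in K by apply/set0Pn; rewrite -card_gt0.
(* For [n = 0] the graph is empty and the zero flow is feasible at every horizon. *)
have [n0|n_gt0] := posnP n.
  exists 0%N, 0%N; rewrite n0 mulr0; split=> //; split=> // k bound.
  have feas tau : mcf_feasible G K ((0%:R + 0%:R) / k) tau.
    exists (fun _ _ _ _ => 0); split=> // [u v _ _ p|p q].
      by rewrite !big1 // subr0 addr0 !mul0r.
    rewrite big1 => [|u _]; last by rewrite big1.
    by rewrite /timed_cap; do 3?[case: ifP => _]; rewrite ?leey ?lee_fin.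
  have [|ln0 _] := @ln_nat_bounds R #|K| (k + 0%:R + 0%:R + 2) K0.
    by rewrite !addr0.
  have zero (D : input_family V 0) : requires_rounds G K 0 D bound.
    move=> Omega P Pi t _ _ _; apply: tau_MCF_le => [|tau []//].
    by rewrite divr_gt0 ?invr_gt0 // exprn_gt0.
  split=> //; exists (fun=> u0) => //.
pose N := #|vertex (n + 3)|; pose M := N.-1.
have NE : N = (32 * (n + 4))%N by rewrite /N card_vertex -addnS.
exists N, M; split; first by rewrite NE; lia.
split.
  apply: le_trans (_ : (320 * n)%:R <= _); first by rewrite ler_nat /M NE; lia.
  rewrite natrM ler_wpM2r // (le_trans _ C3200) // ler_nat; lia.
move=> k bound; set n' := (M%:R + N%:R) / k in bound *.
have kR : 0 < k by rewrite ltr0n.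
have n'0 : 0 < n'.
  by rewrite divr_gt0 // -natrD ltr0n /M NE; move: n_gt0; clear; lia.
pose p := (trunc_log 2 #|K|).+1.
have [|ln0 lnp] := @ln_nat_bounds R #|K| (k + N%:R + M%:R + 2) K0.
  by rewrite lerD2r -addrA lerDl addr_ge0.
pose good (D : input_family V N) tau :=
  forall (Omega : finType) (P : Omega -> R)
    (Pi : Omega -> protocol V {set {set 'I_N}}) (t : nat),
    (forall w, 0 <= P w) -> \sum_w P w = 1 ->
    solves_connectivity G K M P Pi t D -> (tau.+1 <= 1536 * c * p ^ 2 * (2 * t))%N.
have good_le D i j : (i <= j)%N -> good D j -> good D i.
  by move=> ij gj Omega P Pi t P0 P1 /(gj _ _ _ _ P0 P1); apply: leq_trans.
have good_req D : (forall tau, ~ mcf_feasible G K n' tau -> good D tau) ->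
    requires_rounds G K M D bound.
  move=> gD Omega P Pi t P0 P1 sol; apply: tau_MCF_le.
    by rewrite divr_gt0 ?invr_gt0 // exprn_gt0.
  move=> tau /gD/(_ _ _ _ _ P0 P1 sol); rewrite -(ler_nat R) => le.
  move: ln0 lnp; set L := ln _ => ln0 lnp.
  rewrite -mulrA ler_pdivrMl // mulrC ler_pdivrMr ?exprn_gt0 //.
  apply: le_trans le _; rewrite !natrM.
  have p2 : p%:R * p%:R <= 16 * L ^+ 2.
    have -> : 16 * L ^+ 2 = (4 * L) ^+ 2 by ring.
    by rewrite -expr2 lerXn2r ?nnegrE ?ler0n ?mulr_ge0 // ltW.
  have ct : 0 <= c%:R * t%:R :> R by rewrite mulr_ge0.
  have := ler_wpM2l ct p2; rewrite /cc.
  move: (c%:R : R) (t%:R : R) (p%:R * p%:R : R) (L ^+ 2); clear => x y z w.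
  lra.
have inst tau : ~ mcf_feasible G K n' tau ->
    exists2 s : 'I_N -> V, (forall w, s w \in K) &
      good (node_inputs K C s) tau /\ good (@edge_inputs R V K N C) tau.
  move=> infeas.
  have [A [B [d [beta [[AK BK] [A0 B0] [dA dB] le_beta [cA cB]]]]]] :=
    moving_cut (leq_trans (isT : 0 < 640)%N c640) n'0 infeas.
  have beta0 : (0 < beta)%N.
    by rewrite lt0n; apply/eqP => b0; rewrite b0 muln0 in le_beta.
  have [s sK Hs] := hard_instance n_gt0 c640 C3200 AK BK A0 B0 dA dB beta0 cA cB.
  exists s => //; split=> Omega P Pi t P0 P1 sol; apply: leq_trans le_beta _;
    rewrite leq_mul2l; apply/orP; right; apply: ltnW.
    by apply: Hs sol => //; left.
  by apply: Hs sol => //; right.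
have edges : requires_rounds G K M (@edge_inputs R V K N C) bound.
  by apply: good_req => tau /inst[s _ []].
split=> //.
  by apply: requires_rounds_sub edges => x H [[]].
pose s0 : {ffun 'I_N -> V} := [ffun=> u0].
have [||s Hs] := @exists_uniform_witness {ffun 'I_N -> V}
  (fun s tau => (forall w, s w \in K) /\ good (node_inputs K C s) tau)
  (fun tau => ~ mcf_feasible G K n' tau) s0.
- by move=> s i j ij [sK gs]; split=> //; apply: good_le gs.
- move=> tau /inst[s sK [gs _]]; exists [ffun w => s w].
  by have -> : [ffun w => s w] = s :> (_ -> _) by apply/funext => w; rewrite ffunE.
(* If every horizon is feasible, [Hs] does not even place [s] in [K]; a constant assignment then
   serves. *)
have [[tau infeas]|feas] := pselect (exists tau, ~ mcf_feasible G K n' tau).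
  exists s; first exact: (Hs _ infeas).1.
  by apply: good_req => tau' /Hs[].
exists (fun=> u0) => //; apply: good_req => tau infeas.
by case: feas; exists tau.
Qed.
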